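(* Let $E$ be a Euclidean Jordan algebra of rank $4$. Then the completely positive cone $\mathcal{CP}(E_+)$ over the cone of squares $E_+$ of $E$ is facially exposed if and only if $E$ is Jordan-isomorphic to the Hadamard Euclidean Jordan algebra $\mathbb{R}^4$.
   Context: Euclidean Jordan algebra (EJA): a finite-dimensional real vector space $E$ with a commutative bilinear product $\circ$ satisfying $x\circ((x\circ x)\circ y)=(x\circ x)\circ(x\circ y)$ for all $x,y$, with a unit element, and admitting an inner product $\bullet$ with $(x\circ y)\bullet z=x\bullet(y\circ z)$ for all $x,y,z$ (an associative inner product; fix any one). A Jordan frame is a set $\{c_1,\dots,c_r\}$ of nonzero idempotents, none of which is a sum of two nonzero idempotents, with $c_i\circ c_j=0$ for $i\ne j$ and $c_1+\dots+c_r$ equal to the unit; its cardinality $r$ does not depend on the frame and is the rank of $E$. $E_+=\{x\circ x\mid x\in E\}$ is the associated symmetric cone. Two EJAs are Jordan-isomorphic if there is a linear isomorphism between them preserving the products. The Hadamard EJA $\mathbb{R}^n$ is $\mathbb{R}^n$ with the entrywise product and the standard inner product. For a closed cone $K$ in a finite-dimensional real inner product space $V$ (a cone is a set closed under multiplication by all reals $a\ge 0$), $\mathcal{CP}(K)=\{\sum_{i=1}^k a_i\otimes a_i\mid k\ge1,\ a_i\in K\}$, where $x\otimes x$ is the self-adjoint linear map $y\mapsto (x\bullet y)x$ on $V$. It lies in the space $\mathcal{S}(V)$ of self-adjoint linear transformations on $V$, with the induced inner product. A face of a closed convex cone $C$ is a nonempty convex subcone $F\subseteq C$ such that $a,b\in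 C$ and $a+b\in F$ imply $a,b\in F$. An exposed face is a set $C\cap\{d\}^\perp$ with $d$ in the dual cone $C^*=\{y\mid \langle x,y\rangle\ge0\ \forall x\in C\}$. $C$ is facially exposed if all its faces are exposed. (Facial exposedness of $\mathcal{CP}(E_+)$ does not depend on the chosen associative inner product.) *)

(* Defs.v *)
From HB Require Import structures.
From mathcomp Require Import all_boot all_order all_algebra.
From mathcomp Require Import sesquilinear.
From mathcomp Require Import boolp classical_sets reals convex.

Set Implicit Arguments.
Unset Strict Implicit.
Unset Printing Implicit Defensive.

Import Order.TTheory GRing.Theory Num.Theory.
Local Open Scope ring_scope.
Local Open Scope classical_set_scope.

Notation inner_product V := {dot V for idfun}.

Section CompletelyPositive.
Variables (R : realType) (V : vectType R) (dot : inner_product V).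
Implicit Types (x y : V) (A B : 'End(V)).

(* [x (x) x], the map [y |-> (x . y) x] *)
Definition tensor_square x : 'End(V) := linfun (fun y => dot x y *: x).

Lemma tensor_squareE x y : tensor_square x y = dot x y *: x.
Proof.
have lin : linear (fun z => dot x z *: x).
  by move=> a u v; rewrite linearPr /= scalerDl scalerA.
pose L := GRing.isLinear.Build _ _ _ _ (fun z => dot x z *: x) lin.
pose f : {linear V -> V} := HB.pack (fun z => dot x z *: x) L.
exact: (lfunE f).
Qed.

Definition selfadjoint : set 'End(V) :=
  [set A | forall x y, dot (A x) y = dot x (A y)].

Definition lfun_trace A : R := \tr (passmx.mxof (vbasis {:V}) (vbasis {:V}) A).

(* On [selfadjoint] this is the inner product induced by [dot]:
   [(x (x) x, y (x) y) |-> (x . y)^2]. It need not be positive on 'End(V). *)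
Definition trace_form A B : R := lfun_trace (A \o B)%VF.

Definition cp_cone (K : set V) : set 'End(V) :=
  [set A | exists (k : nat) (a : 'I_k -> V),
     [/\ (1 <= k)%N, forall i, K (a i) & A = \sum_(i < k) tensor_square (a i)]].

End CompletelyPositive.

(* The ambient inner product space is a subspace [S] of [W], with inner product
   the restriction of [ip] to [S]; the cone [C] is included in [S]. *)
Section Faces.
Variables (R : realType) (W : lmodType R) (S : set W) (ip : W -> W -> R).
Variable C : set W.

Definition is_cone (F : set W) :=
  forall (a : R) x, 0 <= a -> F x -> F (a *: x).

Definition dual_cone : set W :=
  [set y | S y /\ forall x, C x -> 0 <= ip x y].

Definition face (F : set W) :=
  [/\ F !=set0, F `<=` C, convex_set F, is_cone F &
      forall a b, C a -> C b -> F (a + b) -> F a /\ F b].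

Definition exposed_face (F : set W) :=
  exists2 d, dual_cone d & F = C `&` [set x | ip x d = 0].

Definition facially_exposed := forall F, face F -> exposed_face F.

End Faces.

Definition associative_form (R : realType) (E : vectType R) (mul : E -> E -> E)
    (dot : E -> E -> R) :=
  forall x y z, dot (mul x y) z = dot x (mul y z).

Record euclidean_jordan_algebra (R : realType) := EJA {
  eja_space :> vectType R;
  jmul : {bilinear eja_space -> eja_space -> eja_space};
  jone : eja_space;
  jmulC : commutative jmul;
  jmul_jordan : forall x y,
    jmul x (jmul (jmul x x) y) = jmul (jmul x x) (jmul x y);
  jmul1 : left_id jone jmul;
  eja_inner : exists dot : inner_product eja_space, associative_form jmul dot
}.

Arguments jmul {R e}.

Section EuclideanJordanAlgebra.
Variables (R : realType) (E : euclidean_jordan_algebra R).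
Implicit Types c x : E.

Definition jidempotent c := jmul c c = c.

Definition primitive_idempotent c :=
  [/\ jidempotent c, c <> 0 &
      ~ exists a b : E, [/\ jidempotent a, a <> 0, jidempotent b, b <> 0 &
                            c = a + b]].

(* The [c i] are automatically distinct, being nonzero idempotents with
   [c i * c j = 0] for [i != j]; so [r] is the cardinality of the frame. *)
Definition jordan_frame (r : nat) (c : 'I_r -> E) :=
  [/\ forall i, primitive_idempotent (c i),
      forall i j, i != j -> jmul (c i) (c j) = 0 &
      \sum_(i < r) c i = jone E].

Definition has_rank (r : nat) := exists c : 'I_r -> E, jordan_frame c.

Definition cone_of_squares : set E := [set jmul x x | x in [set: E]].

End EuclideanJordanAlgebra.

Arguments cone_of_squares {R} E _.

Definition jordan_isomorphic (R : realType) (E F : euclidean_jordan_algebra R) :=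
  exists f : {linear E -> F},
    bijective f /\ forall x y, f (jmul x y) = jmul (f x) (f y).

Section Hadamard.
Variables (R : realType) (n : nat).
Implicit Types x y z : 'rV[R]_n.

Definition hadamard_mul x y : 'rV[R]_n := \row_i (x 0 i * y 0 i).

Lemma hadamard_mul_bilinear :
  bilinear_for *:%R *:%R hadamard_mul.
Proof.
split=> [v a x y|v a x y]; apply/rowP=> i; rewrite !mxE.
  by rewrite mulrDl mulrA.
by rewrite mulrDr mulrCA.
Qed.
HB.instance Definition _ := bilinear_isBilinear.Build R 'rV[R]_n 'rV[R]_n
  'rV[R]_n *:%R *:%R hadamard_mul hadamard_mul_bilinear.

Lemma hadamard_mulC : commutative hadamard_mul.
Proof. by move=> x y; apply/rowP=> i; rewrite !mxE mulrC. Qed.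

Lemma hadamard_mulA : associative hadamard_mul.
Proof. by move=> x y z; apply/rowP=> i; rewrite !mxE mulrA. Qed.

Lemma hadamard_jordan x y :
  hadamard_mul x (hadamard_mul (hadamard_mul x x) y) =
  hadamard_mul (hadamard_mul x x) (hadamard_mul x y).
Proof. by rewrite !hadamard_mulA. Qed.

Lemma hadamard_mul1 : left_id (const_mx 1) hadamard_mul.
Proof. by move=> x; apply/rowP=> i; rewrite !mxE mul1r. Qed.

Definition std_dot x y : R := \sum_i x 0 i * y 0 i.

Lemma std_dot_bilinear : bilinear_for *%R (idfun \; *%R) std_dot.
Proof.
split=> [v a x y|v a x y]; rewrite /std_dot /= mulr_sumr -big_split.
  by apply: eq_bigr => i _; rewrite !mxE mulrDl mulrA.
by apply: eq_bigr => i _; rewrite !mxE mulrDr mulrCA.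
Qed.
HB.instance Definition _ := bilinear_isBilinear.Build R 'rV[R]_n 'rV[R]_n
  R *%R (idfun \; *%R) std_dot std_dot_bilinear.

Lemma std_dot_sym x y : std_dot x y = (-1) ^+ false * idfun (std_dot y x).
Proof. by rewrite mul1r; apply: eq_bigr => i _; rewrite mulrC. Qed.
HB.instance Definition _ := isHermitianSesquilinear.Build R 'rV[R]_n false idfun
  std_dot std_dot_sym.

Lemma std_dot_gt0 x : x != 0 -> 0 < std_dot x x.
Proof.
move=> x0; rewrite lt_def sumr_ge0 ?andbT; last by move=> i _; exact: sqr_ge0.
apply: contra x0 => /eqP x0; apply/eqP/rowP => i; rewrite mxE.
have /psumr_eq0P/(_ x0 i isT)/eqP : forall i, true -> 0 <= x 0 i * x 0 i.
  by move=> j _; exact: sqr_ge0.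
by rewrite mulf_eq0 orbb => /eqP.
Qed.
HB.instance Definition _ := isDotProduct.Build R 'rV[R]_n std_dot std_dot_gt0.

Lemma std_dot_assoc : associative_form hadamard_mul std_dot.
Proof. by move=> x y z; apply: eq_bigr => i _; rewrite !mxE mulrA. Qed.

Lemma hadamard_inner :
  exists dot : inner_product 'rV[R]_n, associative_form hadamard_mul dot.
Proof. exists std_dot; exact: std_dot_assoc. Qed.

Definition hadamard_eja : euclidean_jordan_algebra R :=
  @EJA R 'rV[R]_n hadamard_mul (const_mx 1)
    hadamard_mulC hadamard_jordan hadamard_mul1 hadamard_inner.

End Hadamard.

(* Main.v *)
Require Import Defs.
From mathcomp Require Import all_boot all_order all_algebra.
From mathcomp Require Import sesquilinear boolp classical_sets reals convex.
From HB Require Import structures.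
From mathcomp Require Import interval_inference unstable complex.
From mathcomp Require Import ring lra zify.

(** For the orthant of R^4, complete positivity is a matter of signs: a
    symmetric 4 x 4 matrix is completely positive as soon as it is positive
    semidefinite with nonnegative entries ([dnn_cp], a theorem of Maxfield and
    Minc).  A face of this cone is determined by the kernel and the zero pattern
    of the matrix of one of its elements, chosen of maximal rank and support; the
    sum of a positive semidefinite form carried by that kernel and of the matrix
    units at the zero entries exposes it ([hadamard_facially_exposed]).

    If the algebra is not R^4, some Peirce space between two members [c1], [c2]
    of the frame contains an element [u], which can be scaled so that
    [u * u = c1 + c2] ([frame_diagonal_or_half], [peirce_half_square]).  Together
    with the other two members [c3], [c4] of the frame it spans a copy of
    Sym_2(R) x R x R, with elements [block s v x y z] in which the matrix has
    diagonal [s], [x] and off-diagonal entry [v].  In this subalgebra six squares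
    are chosen, and the smallest face F of the completely positive cone that
    contains the sum A of their tensor squares is not exposed, for two reasons:

    - every copositive form that vanishes at A also vanishes at [c3]
      ([copositive_forced_zero]), so the tensor square of [c3] lies in every
      exposed face that contains F;
    - A minus a positive multiple of the tensor square of [c3] is never
      completely positive ([witness_extremal]).  In any decomposition of such an
      operator into tensor squares each term [b] has [coord_y b * coord_x b = 0],
      because this product is nonnegative on squares and its sum over the terms
      is zero.  On the squares with [coord_y = 0], and on those with
      [coord_x = 0], the form [witness_form] is nonnegative; it vanishes at the
      six squares chosen and takes the value 1 at [c3], so its sum over the terms
      would be negative.

    The form [witness_form] restricts to a copositive form on each of these two
    faces of the cone of squares, but no copositive form on the whole cone has
    these restrictions: this is where exposedness breaks down.

    Two facts about squares in an arbitrary Euclidean Jordan algebra are needed.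
    The inner product of an idempotent with a square is nonnegative, because
    multiplication by an idempotent has its spectrum in {0, 1/2, 1}
    ([idempotent_cubic], [dot_idempotent_square_ge0]); and the Peirce-1 space of
    a primitive idempotent is a line ([primitive_peirce1]), because a polynomial
    of least degree annihilating one of its elements has a real root, which
    yields an idempotent. *)

Set Implicit Arguments.
Unset Strict Implicit.
Unset Printing Implicit Defensive.

Import Order.TTheory GRing.Theory Num.Theory.
Local Open Scope ring_scope.
Local Open Scope classical_set_scope.

(** * Inner products and Jordan multiplication *)


Section InnerProduct.
Variables (R : realType) (V : vectType R) (dot : inner_product V).
Implicit Types (x y z : V) (a : R).

Lemma dotC x y : dot x y = dot y x.
Proof. by rewrite (hermC (dot)) /= expr0 mul1r. Qed.

Lemma dotDl x y z : dot (x + y) z = dot x z + dot y z.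
Proof. exact: linearDl. Qed.

Lemma dotDr x y z : dot z (x + y) = dot z x + dot z y.
Proof. exact: linearDr. Qed.

Lemma dotZl a x y : dot (a *: x) y = a * dot x y.
Proof. exact: linearZl_LR. Qed.

Lemma dotZr a x y : dot x (a *: y) = a * dot x y.
Proof. by rewrite dotC dotZl dotC. Qed.

Lemma dotNl x y : dot (- x) y = - dot x y.
Proof. by rewrite -scaleN1r dotZl mulN1r. Qed.

Lemma dotNr x y : dot x (- y) = - dot x y.
Proof. by rewrite dotC dotNl dotC. Qed.

Lemma dot0l x : dot 0 x = 0.
Proof. by rewrite -(scale0r x) dotZl mul0r. Qed.

Lemma dot0r x : dot x 0 = 0.
Proof. by rewrite dotC dot0l. Qed.

Lemma dot_gt0 x : x <> 0 -> 0 < dot x x.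
Proof. by move/eqP => x0; exact: neq0_dnorm_gt0. Qed.

Lemma dot_ge0 x : 0 <= dot x x.
Proof.
by have [->|/eqP/dot_gt0/ltW//] := eqVneq x 0; rewrite dot0l.
Qed.

Lemma dot_eq0 x : dot x x = 0 -> x = 0.
Proof. by move=> xx; apply: contrapT => /dot_gt0; rewrite xx ltxx. Qed.

(** Reduces an identity between vectors to linear arithmetic over R: after
    pairing with a test vector, bilinearity expands both sides into scalars. *)
Lemma dot_inj x y : (forall z, dot x z = dot y z) -> x = y.
Proof.
move=> xy; apply/eqP; rewrite -subr_eq0; apply/eqP/dot_eq0.
by rewrite dotDl dotNl xy subrr.
Qed.

Lemma dot_suml (I : Type) (r : seq I) (P : pred I) (f : I -> V) y :
  dot (\sum_(i <- r | P i) f i) y = \sum_(i <- r | P i) dot (f i) y.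
Proof.
by apply: (big_morph (fun x => dot x y)) => [u v|]; rewrite ?dotDl ?dot0l.
Qed.

Lemma dot_sumr (I : Type) (r : seq I) (P : pred I) (f : I -> V) y :
  dot y (\sum_(i <- r | P i) f i) = \sum_(i <- r | P i) dot y (f i).
Proof. by rewrite dotC dot_suml; apply: eq_bigr => i _; rewrite dotC. Qed.

Definition dotE := (dotDl, dotDr, dotNl, dotNr, dotZl, dotZr, dot0l, dot0r).

End InnerProduct.

Section JordanAlgebra.
Variables (R : realType) (E : euclidean_jordan_algebra R).
Implicit Types (c e f u x y z w : E) (a : R).
Local Notation "x ** y" := (jmul x y) (at level 40, left associativity).

Lemma jmulDl x y z : (x + y) ** z = x ** z + y ** z.
Proof. exact: linearDl. Qed.

Lemma jmulDr x y z : z ** (x + y) = z ** x + z ** y.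
Proof. exact: linearDr. Qed.

Lemma jmulZl a x y : (a *: x) ** y = a *: (x ** y).
Proof. exact: linearZl_LR. Qed.

Lemma jmulZr a x y : x ** (a *: y) = a *: (x ** y).
Proof. by rewrite jmulC jmulZl jmulC. Qed.

Lemma jmulNl x y : (- x) ** y = - (x ** y).
Proof. by rewrite -scaleN1r jmulZl scaleN1r. Qed.

Lemma jmulNr x y : x ** (- y) = - (x ** y).
Proof. by rewrite jmulC jmulNl jmulC. Qed.

Lemma jmul0l x : 0 ** x = 0.
Proof. by have := jmulZl 0 x x; rewrite !scale0r. Qed.

Lemma jmul0r x : x ** 0 = 0.
Proof. by rewrite jmulC jmul0l. Qed.

Lemma jmul_suml (I : Type) (r : seq I) (P : pred I) (f : I -> E) y :
  (\sum_(i <- r | P i) f i) ** y = \sum_(i <- r | P i) (f i ** y).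
Proof.
by apply: (big_morph (fun x => x ** y)) => [u v|]; rewrite ?jmulDl ?jmul0l.
Qed.

Definition jmulE :=
  (jmulDl, jmulDr, jmulNl, jmulNr, jmulZl, jmulZr, jmul0l, jmul0r).

(** The part of the Jordan identity at [x + z] that is quadratic in [z],
    isolated by adding the identities at [x + z] and [x - z]. *)
Lemma jordan_quadratic x z y :
  x ** ((z ** z) ** y) + 2 *: (z ** ((x ** z) ** y)) =
  (z ** z) ** (x ** y) + 2 *: ((x ** z) ** (z ** y)).
Proof.
have [dot _] := eja_inner E; apply: (dot_inj (dot := dot)) => w.
have H t := congr1 (dot^~ w) (jmul_jordan t y).
have := H (x + z); have := H (x - z); have := H x.
rewrite !(jmulE, dotE) (jmulC z x); lra.
Qed.

(** The complete polarization of the Jordan identity.  All structural facts below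
    come from substituting idempotents and powers for some of its variables. *)
Lemma jordan_linearized x z w y :
  x ** ((z ** w) ** y) + z ** ((x ** w) ** y) + w ** ((x ** z) ** y) =
  (z ** w) ** (x ** y) + (x ** w) ** (z ** y) + (x ** z) ** (w ** y).
Proof.
have [dot _] := eja_inner E; apply: (dot_inj (dot := dot)) => t.
have H s := congr1 (dot^~ t) (jordan_quadratic x s y).
have := H (z + w); have := H z; have := H w.
rewrite !(jmulE, dotE) (jmulC w z); lra.
Qed.

End JordanAlgebra.

(** * Peirce decomposition *)


Section Peirce.
Variables (R : realType) (E : euclidean_jordan_algebra R).
Implicit Types (c e f u x y z w : E) (a : R).
Local Notation "x ** y" := (jmul x y) (at level 40, left associativity).

(** With [e], [e], [x] for the three polarized variables, the identity is a
    multiple of the commutator of the multiplications by [e] and [x]. *)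
Lemma jmul_peirce1_comm e x y :
  e ** e = e -> e ** x = x -> e ** (x ** y) = x ** (e ** y).
Proof.
move=> ee ex; have [dot _] := eja_inner E; apply: (dot_inj (dot := dot)) => t.
have := congr1 (dot^~ t) (jordan_linearized e e x y).
by rewrite ex ee !dotE; lra.
Qed.

Lemma jmul_orthogonal_comm e f y : e ** e = e -> e ** f = 0 ->
  f ** (e ** y) = e ** (f ** y).
Proof.
move=> ee ef; have [dot _] := eja_inner E; apply: (dot_inj (dot := dot)) => t.
have := congr1 (dot^~ t) (jordan_linearized e e f y).
by rewrite ef ee !(jmulE, dotE); lra.
Qed.

(** The multiplication L by an idempotent is a root of L (2 L - 1) (L - 1); its
    eigenvalues are therefore among 0, 1/2 and 1. *)
Lemma idempotent_cubic e w : e ** e = e ->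
  2 *: (e ** (e ** (e ** w))) = 3 *: (e ** (e ** w)) - e ** w.
Proof.
move=> ee; have [dot _] := eja_inner E; apply: (dot_inj (dot := dot)) => t.
have := congr1 (dot^~ t) (jordan_linearized e e w e).
by rewrite !ee (jmulC (e ** w)) (jmulC w) !dotE; lra.
Qed.

(** Where [e] and [f] both act by nonzero scalars, each scalar is 1/2 or 1, and so
    is their sum since [e + f] is idempotent; hence both are 1/2.  The proof is
    the same computation with operators: it combines the cubic relations of [e],
    [f] and [e + f]. *)
Lemma orthogonal_idempotents_half e f y :
  e ** e = e -> f ** f = f -> e ** f = 0 ->
  2 *: (e ** (e ** (f ** y))) = e ** (f ** y).
Proof.
move=> ee ff ef; have [dot _] := eja_inner E.
apply: (dot_inj (dot := dot)) => t.
have C z : f ** (e ** z) = e ** (f ** z) by exact: jmul_orthogonal_comm.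
have gg : (e + f) ** (e + f) = e + f.
  by rewrite !jmulE ee ff (jmulC f) ef addr0 add0r.
have He z := congr1 (dot^~ t) (idempotent_cubic z ee).
have Hf z := congr1 (dot^~ t) (idempotent_cubic z ff).
have Hg z := congr1 (dot^~ t) (idempotent_cubic z gg).
(* the mixed terms of the cubic relation of e + f *)
have S z : dot (e ** (e ** (f ** z))) t + dot (e ** (f ** (f ** z))) t =
           dot (e ** (f ** z)) t.
  have := He z; have := Hf z; have := Hg z.
  rewrite !(jmulE, dotE) !C; lra.
have := S y; have := S (e ** y); have := S (f ** y).
have := He (f ** y); have := Hf (e ** y).
rewrite !(dotE, C); lra.
Qed.

Variables (dot : inner_product E).
Hypothesis hdot : associative_form (jmul : E -> E -> E) dot.

Lemma dot_jmul x y z : dot (x ** y) z = dot y (x ** z).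
Proof. by rewrite (jmulC x y) hdot. Qed.

(** The cubic relation gives L = L^2 + 4 (L - L^2)^2 for the selfadjoint
    multiplication L by [e], and the left-hand side of the inequality pairs [w]
    with L [w]. *)
Lemma dot_idempotent_square_ge0 e w : e ** e = e -> 0 <= dot e (w ** w).
Proof.
move=> ee; have H z := congr1 (dot w) (idempotent_cubic z ee).
suff -> : dot e (w ** w) = dot (e ** w) (e ** w) +
    4 * dot (e ** w - e ** (e ** w)) (e ** w - e ** (e ** w)).
  by rewrite addr_ge0 ?mulr_ge0 ?dot_ge0.
have := H w; have := H (e ** w).
rewrite -hdot !(jmulE, dotE) !dot_jmul; lra.
Qed.

Lemma dot_square_ge0 x a w : 0 < a -> x ** x = a *: x -> 0 <= dot x (w ** w).
Proof.
move=> a0 xx; have : 0 <= dot (a^-1 *: x) (w ** w).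
  apply: dot_idempotent_square_ge0.
  by rewrite !jmulE xx !scalerA -mulrA mulVf ?mulr1// gt_eqF.
by rewrite dotZl pmulr_rge0// invr_gt0.
Qed.

End Peirce.

(** * Real polynomials without real roots *)


Section RealPolynomials.
Variable R : rcfType.

(** A complex root [a + i b] of [p] with [b != 0] makes the minimal polynomial of
    [a + i b] over the reals divide [p]. *)
Lemma real_poly_factor (p : {poly R}) : size p != 1 ->
  (exists a, root p a) \/
  exists a b, b != 0 /\ (('X - a%:P) ^+ 2 + (b ^+ 2)%:P) %| p.
Proof.
move=> p1; have : size (map_poly (real_complex R) p) != 1.
  by rewrite size_map_poly.
case/closed_rootP => -[a b] /rootP pz.
have [b0|b0] := eqVneq b 0.
  left; exists a; apply/rootP; move: pz; rewrite b0.
  by rewrite (_ : a +i* 0 = real_complex R a)%C// horner_map => -[].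
right; exists a, b; split=> //; set q := _ + _.
have sq : size q = 3.
  rewrite size_polyDl ?size_exp_XsubC//.
  by apply: (leq_ltn_trans (size_polyC_leq1 _)).
have q0 : q != 0 by rewrite -size_poly_eq0 sq.
have /eqP := pz; rewrite [in X in map_poly _ X](divp_eq p q) rmorphD rmorphM /=.
rewrite hornerD hornerM.
have -> : (map_poly (real_complex R) q).[(a +i* b)%C] = 0.
  rewrite /q rmorphD rmorphXn rmorphB /= map_polyX !map_polyC /= !hornerE /=.
  rewrite expr2; apply/eqP; rewrite eq_complex /=; apply/andP.
  by split; apply/eqP; ring.
rewrite mulr0 add0r; set r := p %% q.
have sr : (size r <= 2)%N by have := ltn_modp p q; rewrite sq q0.
have rE : r = (r`_0)%:P + (r`_1)%:P * 'X.
  apply/polyP => i; rewrite coefD coefC coefMX coefC.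
  case: i => [|[|i]] /=; rewrite ?addr0 ?add0r//.
  by rewrite nth_default// (leq_trans sr).
rewrite rE rmorphD rmorphM /= map_polyX !map_polyC /= !hornerE.
rewrite eq_complex /= => /andP[/eqP re /eqP im].
have r1 : r`_1 = 0.
  move/eqP: im; rewrite !(mul0r, add0r, addr0) mulf_eq0 (negPf b0) orbF.
  by move/eqP.
have r0 : r`_0 = 0 by move: re; rewrite r1 !mul0r subr0 addr0.
by apply/modp_eq0P; rewrite -/r rE r0 r1 polyC0 mul0r addr0.
Qed.

End RealPolynomials.

(** * Primitive idempotents *)


Section PrimitiveIdempotent.
Variables (R : realType) (E : euclidean_jordan_algebra R) (c x : E).
Hypotheses (cc : jmul c c = c) (cx : jmul c x = x).
Implicit Types (y z : E) (p q : {poly R}).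
Local Notation "x ** y" := (jmul x y) (at level 40, left associativity).

(** In the Peirce-1 space the idempotent [c] is the unit, so it plays the part of
    the zeroth power of [x]. *)
Definition jpow (n : nat) : E := iter n (jmul x) c.

(** The polarized identity at [x], [x] and a power of [x], which expresses the
    multiplication by a power through multiplications by lower ones. *)
Lemma jpow_recl n y : jpow n.+2 ** y =
  (x ** x) ** (jpow n ** y) + 2 *: (jpow n.+1 ** (x ** y))
  - x ** (x ** (jpow n ** y)) - jpow n ** (x ** (x ** y)).
Proof.
have [dot _] := eja_inner E; apply: (dot_inj (dot := dot)) => t.
have := congr1 (dot^~ t) (jordan_linearized x (jpow n) y x).
rewrite /jpow /= -/(jpow n) !(jmulC _ x) (jmulC y) (jmulC _ (x ** x)).
by rewrite (jmulC (x ** y)) !dotE; lra.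
Qed.

(** Power associativity in operator form. *)
Lemma jpow_comm n y : jpow n ** (x ** y) = x ** (jpow n ** y).
Proof.
elim/ltn_ind: n y => -[|[|n]] IH y; first exact: jmul_peirce1_comm.
  by rewrite /jpow /= (jmulC x) cx.
have IH0 z := IH n (leqnSn _) z; have IH1 z := IH n.+1 (leqnn _) z.
rewrite !jpow_recl !IH0 !IH1 -!jmul_jordan.
by rewrite !(jmulE).
Qed.

Lemma jpow_unit n : c ** jpow n = jpow n.
Proof.
by elim: n => [|n IH] //=; rewrite /jpow /= -/(jpow n) (jpow_comm 0) IH.
Qed.

Lemma jpowD m n : jpow m ** jpow n = jpow (m + n).
Proof.
elim: n => [|n IH]; first by rewrite addn0 jmulC jpow_unit.
by rewrite {2}/jpow /= jpow_comm IH addnS.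
Qed.

Definition jeval p : E := \sum_(i < size p) p`_i *: jpow i.

Lemma jeval_widen n p : (size p <= n)%N ->
  jeval p = \sum_(i < n) p`_i *: jpow i.
Proof.
move=> pn; rewrite /jeval (big_ord_widen n (fun i => p`_i *: jpow i))//.
rewrite big_mkcond; apply: eq_bigr => i _; case: ltnP => // ip.
by rewrite nth_default// scale0r.
Qed.

Lemma jevalD p q : jeval (p + q) = jeval p + jeval q.
Proof.
pose n := maxn (size p) (size q).
rewrite (@jeval_widen n) ?size_polyD// (@jeval_widen n p) ?leq_maxl//.
rewrite (@jeval_widen n q) ?leq_maxr// -big_split; apply: eq_bigr => i _.
by rewrite coefD scalerDl.
Qed.

Lemma jevalZ a p : jeval (a *: p) = a *: jeval p.
Proof.
rewrite (@jeval_widen (size p)) ?size_scale_leq// scaler_sumr.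
by apply: eq_bigr => i _; rewrite coefZ scalerA.
Qed.

Lemma jevalMX p : jeval (p * 'X) = x ** jeval p.
Proof.
rewrite (@jeval_widen (size p).+1); last first.
  by rewrite (leq_trans (size_polyMleq _ _))// size_polyX addn2.
rewrite big_ord_recl coefMX /= scale0r add0r.
rewrite /jeval linear_sumr; apply: eq_bigr => i _.
by rewrite coefMX /= jmulZr.
Qed.

Lemma jeval_unit p : c ** jeval p = jeval p.
Proof.
by rewrite linear_sumr; apply: eq_bigr => i _; rewrite jmulZr jpow_unit.
Qed.

(** An eigenvector of [x] that is a polynomial in [x] spans a line closed under
    products, so it is a multiple of an idempotent unless its square vanishes. *)
Lemma jeval_eigen p q a :
  x ** jeval q = a *: jeval q -> jeval q ** jeval p = p.[a] *: jeval q.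
Proof.
move=> xq; rewrite horner_coef scaler_suml linear_sumr; apply: eq_bigr => i _.
rewrite jmulZr -scalerA; congr (_ *: _).
elim: (nat_of_ord i) => [|n IH] /=; first by rewrite scale1r jmulC jeval_unit.
have -> : jeval q ** jpow n.+1 = x ** (jeval q ** jpow n).
  rewrite !(jmulC (jeval q)) !linear_sumr.
  by apply: eq_bigr => j _; rewrite !jmulZr !jpowD addSn.
by rewrite IH jmulZr xq scalerA exprSr.
Qed.

Lemma jeval_annihilator : exists2 p, p != 0 & jeval p = 0.
Proof.
pose n := (\dim {:E}).+1.
pose X := [tuple jpow i | i < n].
have nf : ~~ free X.
  by rewrite /free neq_ltn size_tuple ltnS dimvS ?subvf.
have [k [k0 [i ki]]] : exists k : 'I_n -> R,
    \sum_(i < n) k i *: X`_i = 0 /\ exists i, k i <> 0.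
  apply: contrapT => H; move/negP: nf; apply; apply/freeP => k k0 i.
  apply: contrapT => ki.
  by apply: H; exists k; split=> //; exists i.
exists (\poly_(j < n) k (inord j)).
  apply/eqP => /polyP/(_ i); rewrite coef_poly ltn_ord inord_val coef0.
  exact: ki.
rewrite (@jeval_widen n) ?size_poly// -[RHS]k0; apply: eq_bigr => j _.
rewrite coef_poly ltn_ord inord_val (nth_map j) ?size_enum_ord//.
by rewrite nth_ord_enum.
Qed.

(** Induction on the degree of a polynomial annihilating [x].  A quadratic factor
    without real roots is superfluous, since [(x - a)^2 w + b^2 w = 0] forces
    [w = 0] when multiplication by [x] is selfadjoint.  A linear factor ['X - a]
    is superfluous too, or else leaves a polynomial [w] in [x] with [x w = a w];
    a multiple of [w] is then an idempotent below [c], hence equal to [c], and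
    [x = x c = a c]. *)
Lemma primitive_peirce1 : primitive_idempotent c -> exists a, x = a *: c.
Proof.
case=> _ c0 cprim; have [dot hdot] := eja_inner E.
have [p p0 xp] := jeval_annihilator.
elim: {p}(size p) {-2}p (leqnn (size p)) p0 xp => [|n IH] p pn p0 xp.
  by move: p0; rewrite -size_poly_eq0 -leqn0 pn.
have [p1|p1] := eqVneq (size p) 1.
  have pE := size1_polyC (eq_leq p1); exfalso; apply: c0; move: xp.
  rewrite pE (@jeval_widen 1) ?size_polyC_leq1//.
  rewrite big_ord1 coefC /= => /eqP; rewrite scaler_eq0 => /orP[/eqP pc|/eqP//].
  by move: p0; rewrite pE pc eqxx.
have [[a /factor_theorem[g pE]]|[a [b [b0 /dvdpP[g pE]]]]] :=
  real_poly_factor p1.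
  have g0 : g != 0 by apply: contraNneq p0 => g0; rewrite pE g0 mul0r.
  have sg : (size g <= n)%N.
    rewrite -ltnS (leq_trans _ pn)// pE size_Mmonic ?monicXsubC//.
    by rewrite size_XsubC addn2.
  have [w0|w0] := eqVneq (jeval g) 0; first exact: (IH g).
  set w := jeval g in w0; have xw : x ** w = a *: w.
    apply/eqP; rewrite -subr_eq0 -xp pE.
    have -> : g * ('X - a%:P) = g * 'X + (- a) *: g.
      by rewrite -mul_polyC rmorphN /=; ring.
    by rewrite jevalD jevalZ jevalMX scaleNr.
  have ww : w ** w = g.[a] *: w by exact: jeval_eigen.
  have ga : g.[a] != 0.
    apply: contra w0 => /eqP ga; apply/eqP/(dot_eq0 (dot := dot)).
    by have := hdot c w w; rewrite ww ga scale0r dot0r [c ** w]jeval_unit.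
  pose e := g.[a]^-1 *: w.
  have ce : c ** e = e by rewrite jmulZr jeval_unit.
  have ee : e ** e = e by rewrite !jmulE ww !scalerA mulfVK.
  have e0 : e <> 0 by apply/eqP; rewrite scaler_eq0 invr_eq0 negb_or ga.
  have xe : x ** e = a *: e by rewrite jmulZr xw !scalerA mulrC.
  clearbody e; have /eqP : c - e = 0.
    apply: contrapT => ce0; apply: cprim; exists e, (c - e); split=> //.
      by rewrite /jidempotent !jmulE (jmulC e c) cc ce ee opprK addNr addr0.
    by rewrite addrC subrK.
  rewrite subr_eq0 => /eqP cE; exists a.
  by rewrite -[x in LHS]cx jmulC cE xe.
have g0 : g != 0 by apply: contraNneq p0 => g0; rewrite pE g0 mul0r.
have w0 : jeval g = 0.
  set w := jeval g; apply: (dot_eq0 (dot := dot)).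
  have : x ** (x ** w) - 2 * a *: (x ** w) + (a ^+ 2 + b ^+ 2) *: w = 0.
    rewrite -xp pE.
    have -> : g * (('X - a%:P) ^+ 2 + (b ^+ 2)%:P) =
        g * 'X * 'X + (- (2 * a)) *: (g * 'X) + (a ^+ 2 + b ^+ 2) *: g.
      by rewrite -!mul_polyC rmorphN rmorphD rmorphM !rmorphXn /=; ring.
    by rewrite !jevalD !jevalZ !jevalMX scaleNr.
  move/(congr1 (dot w)); rewrite !dotE -[dot w (x ** (x ** w))]hdot.
  have := dot_ge0 dot (x ** w - a *: w); rewrite !dotE (dotC dot w (x ** w)).
  rewrite (jmulC w x) => h1 h2.
  have h3 := dot_ge0 dot w.
  have : b ^+ 2 * dot w w <= 0 by lra.
  rewrite pmulr_rle0; last by rewrite exprn_even_gt0.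
  by move=> h4; apply/eqP; rewrite eq_le h3 h4.
apply: (IH g) => //; rewrite -ltnS (leq_trans _ pn)// pE size_mul//; last first.
  by apply: contraNneq p0 => q0; rewrite pE q0 mulr0.
rewrite size_polyDl ?size_exp_XsubC; last first.
  exact: (leq_ltn_trans (size_polyC_leq1 _)).
by rewrite addn3.
Qed.

End PrimitiveIdempotent.

(** * Off-diagonal Peirce spaces *)


Section PeirceHalf.
Variables (R : realType) (E : euclidean_jordan_algebra R).
Implicit Types (c e f u x y z : E) (a : R).
Local Notation "x ** y" := (jmul x y) (at level 40, left associativity).

Definition peirce_half e f u := 2 *: (e ** u) = u /\ 2 *: (f ** u) = u.

Lemma halfE e u : 2 *: (e ** u) = u -> e ** u = 2^-1 *: u.
Proof. by move=> {2}<-; rewrite scalerA mulVf ?scale1r// pnatr_eq0. Qed.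

(** The square of an element of the Peirce-1/2 space of [e] has no component
    there: the polarized identity at [e], [u], [u] and [e] says that multiplying
    by [e] a second time changes nothing. *)
Lemma half_square_peirce1 e u : e ** e = e -> 2 *: (e ** u) = u ->
  e ** (e ** (u ** u)) = e ** (u ** u).
Proof.
move=> ee /halfE eu; have [dot _] := eja_inner E.
apply: (dot_inj (dot := dot)) => t.
have := congr1 (dot^~ t) (jordan_linearized e u u e).
rewrite !(jmulC _ e) ee eu !jmulE !(jmulC _ e) eu !jmulE !dotE; lra.
Qed.

Lemma half_sum_peirce1 e f u : peirce_half e f u -> (e + f) ** u = u.
Proof.
case=> /halfE eu /halfE fu; rewrite jmulDl eu fu -scalerDl -[RHS]scale1r.
by congr (_ *: _); lra.
Qed.

(** The element [u] is fixed by the idempotent [e + f], which is orthogonal to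
    [g]; a nonzero product with [g] would require the eigenvalue 1/2 instead. *)
Lemma orthogonal_peirce_half e f g u : e ** e = e -> f ** f = f ->
  g ** g = g -> e ** f = 0 -> e ** g = 0 -> f ** g = 0 ->
  peirce_half e f u -> g ** u = 0.
Proof.
move=> ee ff gg ef eg fg /half_sum_peirce1 hu.
have hh : (e + f) ** (e + f) = e + f.
  by rewrite !jmulE ee ff (jmulC f) ef addr0 add0r.
have hg : (e + f) ** g = 0 by rewrite jmulDl eg fg addr0.
have := orthogonal_idempotents_half u hh gg hg.
rewrite -(jmul_orthogonal_comm u hh hg) hu.
rewrite -(jmul_orthogonal_comm u hh hg) hu => /eqP.
by rewrite scaler_nat mulr2n -subr_eq0 addrK => /eqP.
Qed.

(** By primitivity [u * u = a e + b f].  The associative inner product shows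
    [a > 0], and the Jordan identity [u (u^2 u) = u^2 u^2] shows [a = b]. *)
Lemma peirce_half_square e f u : primitive_idempotent e ->
  primitive_idempotent f -> e ** f = 0 -> u <> 0 -> peirce_half e f u ->
  exists2 a, 0 < a & u ** u = a *: (e + f).
Proof.
move=> pe pf ef u0 hu; have [ee e0 _] := pe; have [ff f0 _] := pf.
have [eu fu] := hu; have [dot hdot] := eja_inner E.
have [a eaE] := primitive_peirce1 ee (half_square_peirce1 ee eu) pe.
have [b fbE] := primitive_peirce1 ff (half_square_peirce1 ff fu) pf.
have hh : (e + f) ** (e + f) = e + f.
  by rewrite !jmulE ee ff (jmulC f) ef addr0 add0r.
have uu : u ** u = a *: e + b *: f.
  rewrite -eaE -fbE -jmulDl (jmul_peirce1_comm u hh) ?half_sum_peirce1//.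
have a0 : 0 < a.
  rewrite -(pmulr_lgt0 _ (dot_gt0 dot e0)) -dotZl -eaE (dot_jmul hdot) ee.
  rewrite (dot_jmul hdot) (jmulC u) (halfE eu) dotZr.
  by rewrite mulr_gt0// ?dot_gt0// invr_gt0.
suff ab : a = b by exists a => //; rewrite uu -ab scalerDr.
have := jmul_jordan u u; rewrite uu => /(congr1 (dot e)).
rewrite !jmulE (halfE eu) (halfE fu) !jmulE uu ee ff (jmulC f) ef.
have ef0 : dot e f = 0 by rewrite -ee hdot ef dot0r.
rewrite !dotE ef0; have := dot_gt0 dot e0 => e1 h.
have : a * (a - b) * dot e e = 0 by nra.
by move/eqP; rewrite !mulf_eq0 (gt_eqF e1) (gt_eqF a0) orbF subr_eq0 => /eqP.
Qed.

(** The products [c i (c j x)] with [i != j] lie in the off-diagonal Peirce spaces.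
    When all of them vanish, [c i x] is fixed by [c i], hence a multiple of it,
    and [x] is the sum of the [c i x]. *)
Lemma frame_diagonal_or_half r (c : 'I_r -> E) : jordan_frame c ->
  (forall x, exists a : 'I_r -> R, x = \sum_i a i *: c i) \/
  exists i j u, [/\ i != j, u <> 0 & peirce_half (c i) (c j) u].
Proof.
case=> prim orth one; have [|nhalf] := pselect (exists i j u,
  [/\ i != j, u <> 0 & peirce_half (c i) (c j) u]); first by right.
have cc i : c i ** c i = c i by case: (prim i).
left=> x; have zero i j : i != j -> c i ** (c j ** x) = 0.
  move=> ij; apply: contrapT => nz; apply: nhalf.
  exists i, j, (c i ** (c j ** x)); split=> //; split.
    by apply: orthogonal_idempotents_half => //; exact: orth.
  rewrite (jmul_orthogonal_comm x (cc j)) ?orth// 1?eq_sym//.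
  by apply: orthogonal_idempotents_half => //; rewrite orth// eq_sym.
have proj i : c i ** (c i ** x) = c i ** x.
  rewrite -[in RHS](jmul1 x) -one jmul_suml linear_sumr (bigD1 i)//=.
  rewrite big1 ?addr0//.
  by move=> j ji; apply: zero; rewrite eq_sym.
have /choice[a aE] : forall i, exists a, c i ** x = a *: c i.
  by move=> i; exact: (primitive_peirce1 (cc i) (proj i) (prim i)).
by exists a; rewrite -[LHS]jmul1 -one jmul_suml; apply: eq_bigr.
Qed.

End PeirceHalf.

(** * Copositive forms on a five-dimensional cone *)


Section ForcedZero.
Variable R : realType.

(** The first-order condition at a zero [p] of a form copositive on a convex cone
    that contains [r]: [b] stands for the polar form at [p] and [r], and [c] for
    the value of the form at [r]. *)
Lemma first_variation_ge0 (b c : R) :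
  (forall e, 0 < e -> 0 <= 2 * e * b + e ^+ 2 * c) -> 0 <= b.
Proof.
move=> H; rewrite leNgt; apply/negP => b0.
pose k := `|c| + 1; have k0 : 0 < k by rewrite ltr_wpDl.
have ck : c <= k by rewrite (le_trans (ler_norm c))// lerDl.
have e0 : 0 < - b / k by rewrite divr_gt0// oppr_gt0.
have := H _ e0; set e := - b / k in e0 *.
have ek : e * k = - b by rewrite mulfVK// gt_eqF.
have : e * c <= - b by rewrite -ek ler_pM2l.
by nra.
Qed.

Lemma linear_part0 (p q : R) : (forall t, 0 <= t * p + t ^+ 2 * q) -> p = 0.
Proof.
move=> H; apply/eqP; rewrite eq_le -oppr_ge0.
have h1 : 0 <= p / 2.
  by apply: (@first_variation_ge0 _ q) => e _; have := H e; lra.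
have h2 : 0 <= - p / 2.
  by apply: (@first_variation_ge0 _ q) => e _; have := H (- e); lra.
by apply/andP; split; lra.
Qed.

(** The form lives on the product of the cone of positive semidefinite matrices
    [[s, v], [v, x]] with two half-lines.  At each of its zeros the polar form is
    nonnegative on the cone.  With [m = dyy], the first five zeros then give
    [dss = dxx = dzz = dsz = m], [dsx = dsy = dyz = - m] and
    [dvv = dsv = dvx = dvz = 0].  The last zero turns this into [dxz = - 7 m],
    whereas the first-order condition at [(1, 0, 1, 0, 0)] in the direction of
    [z] is [dsz + dxz >= 0]; so [m <= 0]. *)
Lemma copositive_forced_zero
    (dss dvv dxx dyy dzz dsv dsx dsy dsz dvx dvy dvz dxy dxz dyz : R) :
  let q s v x y z := dss * s ^+ 2 + dvv * v ^+ 2 + dxx * x ^+ 2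
    + dyy * y ^+ 2 + dzz * z ^+ 2 + 2 * (dsv * s * v + dsx * s * x
    + dsy * s * y + dsz * s * z + dvx * v * x + dvy * v * y + dvz * v * z
    + dxy * x * y + dxz * x * z + dyz * y * z) in
  (forall s v x y z, 0 <= s -> 0 <= x -> v ^+ 2 <= s * x -> 0 <= y -> 0 <= z ->
    0 <= q s v x y z) ->
  q 1 0 1 0 0 = 0 -> q 1 1 1 0 0 = 0 -> q 1 0 0 1 0 = 0 -> q 0 0 0 1 1 = 0 ->
  q 1 0 0 2 1 = 0 -> q 4 2 1 0 3 = 0 -> dyy = 0.
Proof.
move=> q H; rewrite /q => qt qp qa qb qab qw.
have ts : 0 <= dss + dsx.
  apply: (@first_variation_ge0 _ (dss)) => e e0.
  have : 0 <= q (1 + e) 0 1 0 0 by apply: H; clear -e0; nra.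
  by rewrite /q; lra.
have tx : 0 <= dsx + dxx.
  apply: (@first_variation_ge0 _ (dxx)) => e e0.
  have : 0 <= q 1 0 (1 + e) 0 0 by apply: H; clear -e0; nra.
  by rewrite /q; lra.
have [ts0 tx0] : dss + dsx = 0 /\ dsx + dxx = 0 by split; lra.
have tp : 0 <= dss + dsx + (dsx + dxx) + (dsv + dvx).
  apply: (@first_variation_ge0 _
    (dss + dxx + dvv + 2 * dsx + 2 * dsv + 2 * dvx)) => e e0.
  have : 0 <= q (1 + e) e (1 + e) 0 0 by apply: H; clear -e0; nra.
  by rewrite /q; lra.
have tn : 0 <= dss + dsx + (dsx + dxx) - (dsv + dvx).
  apply: (@first_variation_ge0 _
    (dss + dxx + dvv + 2 * dsx - 2 * dsv - 2 * dvx)) => e e0.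
  have : 0 <= q (1 + e) (- e) (1 + e) 0 0 by apply: H; clear -e0; nra.
  by rewrite /q; lra.
have tv0 : dsv + dvx = 0 by lra.
have vv0 : dvv = 0 by lra.
have ps : 0 <= dss + dsv + dsx.
  apply: (@first_variation_ge0 _ (dss)) => e e0.
  have : 0 <= q (1 + e) 1 1 0 0 by apply: H; clear -e0; nra.
  by rewrite /q; lra.
have px : 0 <= dsx + dvx + dxx.
  apply: (@first_variation_ge0 _ (dxx)) => e e0.
  have : 0 <= q 1 1 (1 + e) 0 0 by apply: H; clear -e0; nra.
  by rewrite /q; lra.
have [sv0 vx0] : dsv = 0 /\ dvx = 0 by split; lra.
have as_ : 0 <= dss + dsy.
  apply: (@first_variation_ge0 _ (dss)) => e e0.
  have : 0 <= q (1 + e) 0 0 1 0 by apply: H; clear -e0; nra.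
  by rewrite /q; lra.
have ay : 0 <= dsy + dyy.
  apply: (@first_variation_ge0 _ (dyy)) => e e0.
  have : 0 <= q 1 0 0 (1 + e) 0 by apply: H; clear -e0; nra.
  by rewrite /q; lra.
have [as0 ay0] : dss + dsy = 0 /\ dsy + dyy = 0 by split; lra.
have vy0 : dsv + dvy = 0.
  apply: (@linear_part0 _ (dsx + dxy)) => t.
  suff : 0 <= dss + dsy + t * (dsv + dvy) + t ^+ 2 * (dsx + dxy) by lra.
  apply: (@first_variation_ge0 _ (dss + t ^+ 2 * dvv + t ^+ 4 * dxx
    + 2 * (t * dsv + t ^+ 2 * dsx + t ^+ 3 * dvx))) => e e0.
  have t2 : 0 <= t ^+ 2 by exact: sqr_ge0.
  have : 0 <= q (1 + e) (e * t) (e * t ^+ 2) 1 0 by apply: H; clear -e0 t2; nra.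
  by rewrite /q; lra.
have by_ : 0 <= dyy + dyz.
  apply: (@first_variation_ge0 _ (dyy)) => e e0.
  have : 0 <= q 0 0 0 (1 + e) 1 by apply: H; clear -e0; nra.
  by rewrite /q; lra.
have bz : 0 <= dyz + dzz.
  apply: (@first_variation_ge0 _ (dzz)) => e e0.
  have : 0 <= q 0 0 0 1 (1 + e) by apply: H; clear -e0; nra.
  by rewrite /q; lra.
have [by0 bz0] : dyy + dyz = 0 /\ dyz + dzz = 0 by split; lra.
have sz0 : dsy + dsz = 0 by lra.
have vz0 : dvy + dvz = 0.
  apply: (@linear_part0 _ (dxy + dxz)) => t.
  suff : 0 <= dsy + dsz + t * (dvy + dvz) + t ^+ 2 * (dxy + dxz) by lra.
  apply: (@first_variation_ge0 _ (dss + t ^+ 2 * dvv + t ^+ 4 * dxx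
    + 2 * (t * dsv + t ^+ 2 * dsx + t ^+ 3 * dvx))) => e e0.
  have t2 : 0 <= t ^+ 2 by exact: sqr_ge0.
  have : 0 <= q e (e * t) (e * t ^+ 2) 1 1 by apply: H; clear -e0 t2; nra.
  by rewrite /q; lra.
have tz : 0 <= dsz + dxz.
  apply: (@first_variation_ge0 _ (dzz)) => e e0.
  have : 0 <= q 1 0 1 0 e by apply: H; clear -e0; nra.
  by rewrite /q; lra.
have yy : 0 <= dyy.
  have : 0 <= q 0 0 0 1 0 by apply: H; clear; lra.
  by rewrite /q; lra.
lra.
Qed.
End ForcedZero.

(** * Convex cones, their faces and completely positive cones *)


Section ConeFaces.
Variables (R : realType) (W : lmodType R) (C : set W).
Implicit Types (F : set W) (x y : W) (a : R).

Definition add_closed_set F := forall x y, F x -> F y -> F (x + y).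

Lemma convex_cone_convex F : add_closed_set F -> is_cone F -> convex_set F.
Proof.
move=> Fadd Fcone x y l /set_mem Fx /set_mem Fy; apply/mem_set.
apply: Fadd; apply: Fcone => //.
have : l%:num <= 1 by [].
by rewrite -subr_ge0.
Qed.

Lemma convex_cone_add F : convex_set F -> is_cone F -> add_closed_set F.
Proof.
move=> Fconv Fcone x y Fx Fy.
have h0 : (0 : R) <= 2^-1 by lra.
have h1 : 2^-1 <= 1 :> R by lra.
have := Fconv x y (Itv01 h0 h1) (mem_set Fx) (mem_set Fy) => /set_mem.
move=> /(Fcone 2 _ (ler0n _ _)); congr F.
rewrite scalerDr !scalerA [X in X *: _ + _]mulfV ?pnatr_eq0// scale1r.
congr (_ + _); rewrite -[RHS]scale1r; congr (_ *: _).
rewrite /unstable.onem /=; lra.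
Qed.

Hypotheses (Cadd : add_closed_set C) (Ccone : is_cone C).

(** The smallest face of [C] containing [p]. *)
Definition generated_face (p : W) : set W :=
  [set x | C x /\ exists2 e : R, 0 < e & C (p - e *: x)].

Lemma cone_segment p x a b : C x -> b <= a -> C (p - a *: x) -> C (p - b *: x).
Proof.
move=> Cx ba pa; have -> : p - b *: x = p - a *: x + (a - b) *: x.
  by rewrite scalerBl addrA subrK.
by apply: Cadd => //; apply: Ccone => //; rewrite subr_ge0.
Qed.

Lemma generated_face_face p : C p -> face C (generated_face p).
Proof.
move=> Cp; have C0 : C 0 by rewrite -(scale0r p); exact: Ccone.
have genZ : is_cone (generated_face p).
  move=> a x; rewrite le_eqVlt => /orP[/eqP<-|a0] [Cx [e e0 pe]].
    rewrite scale0r; split=> //; exists 1 => //.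
    by rewrite scaler0 subr0.
  split; first exact: Ccone (ltW a0) Cx.
  exists (e / a); first exact: divr_gt0.
  by rewrite scalerA mulfVK// gt_eqF.
have genD : add_closed_set (generated_face p).
  move=> x y [Cx [e e0 pe]] [Cy [f f0 pf]]; split; first exact: Cadd.
  pose g := Num.min e f; exists (g / 2); first by rewrite divr_gt0// lt_min e0.
  have -> : p - (g / 2) *: (x + y) = 2^-1 *: ((p - g *: x) + (p - g *: y)).
    rewrite addrACA -opprD -scalerDr scalerBr scalerA mulrC; congr (_ - _).
    by rewrite -mulr2n -scaler_nat scalerA mulVf ?scale1r// pnatr_eq0.
  apply: Ccone; first by rewrite invr_ge0.
  apply: Cadd; [apply: cone_segment pe|apply: cone_segment pf] => //.
    by rewrite ge_min lexx.
  by rewrite ge_min lexx orbT.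
split=> //.
- by exists p; split=> //; exists 1 => //; rewrite scale1r subrr.
- by move=> x [].
- exact: convex_cone_convex.
- have half (a b : W) : C a -> C b ->
      generated_face p (a + b) -> generated_face p a.
    move=> Ca Cb [_ [e e0 pe]]; split=> //; exists e => //.
    have -> : p - e *: a = p - e *: (a + b) + e *: b.
      by rewrite scalerDr opprD addrA subrK.
    by apply: Cadd => //; apply: Ccone => //; exact: ltW.
  move=> a b Ca Cb ab; split; first exact: half ab.
  by apply: (half b a) => //; rewrite addrC.
Qed.

End ConeFaces.

Section CompletelyPositive.
Variables (R : realType) (V : vectType R) (dot : inner_product V) (K : set V).
Implicit Types (x y : V) (A B D : 'End(V)).

Lemma trace_formDl A B D :
  trace_form (A + B) D = trace_form A D + trace_form B D.
Proof.
rewrite /trace_form /lfun_trace comp_lfunDl.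
rewrite -[X in passmx.mxof _ _ (X + _)]scale1r.
by rewrite passmx.mxof_linear scale1r mxtraceD.
Qed.

Lemma trace_form0l D : trace_form 0 D = 0.
Proof. by have /eqP := trace_formDl 0 0 D; rewrite addr0 => /eqP; lra. Qed.

Lemma trace_form_suml (I : Type) (r : seq I) (P : pred I) (f : I -> 'End(V)) D :
  trace_form (\sum_(i <- r | P i) f i) D =
  \sum_(i <- r | P i) trace_form (f i) D.
Proof.
by apply: (big_morph (fun A => trace_form A D)) => [A B|];
  rewrite ?trace_formDl ?trace_form0l.
Qed.

Lemma trace_form_tensor x D : trace_form (tensor_square dot x) D = dot x (D x).
Proof.
rewrite /trace_form /lfun_trace; pose e := vbasis {:V}.
have eb : basis_of {:V} e by exact: vbasisP.
transitivity (\sum_(i < \dim {:V}) dot x (D e`_i) * coord e i x).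
  apply: eq_bigr => i _; rewrite mxE /= mxE passmx.vecof_delta.
  by rewrite comp_lfunE tensor_squareE linearZ.
rewrite [X in _ = dot x (D X)](coord_basis eb (memvf x)).
rewrite linear_sum dot_sumr; apply: eq_bigr => i _.
by rewrite linearZ dotZr mulrC.
Qed.

Lemma tensor_squareZ a x :
  tensor_square dot (a *: x) = a ^+ 2 *: tensor_square dot x.
Proof.
apply/lfunP => y; rewrite lfunE /= !tensor_squareE dotZl !scalerA.
by rewrite mulrAC expr2.
Qed.

Lemma cp_cone_add : add_closed_set (cp_cone dot K).
Proof.
move=> _ _ [k [a [k1 Ka ->]]] [l [b [l1 Kb ->]]].
exists (k + l)%N, (fun i => match split i with inl j => a j | inr j => b j end).
split; first by rewrite addn_gt0 k1.
  by move=> i; case: split => j.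
rewrite big_split_ord; congr (_ + _); apply: eq_bigr => i _.
  by rewrite (unsplitK (inl i)).
by rewrite (unsplitK (inr i)).
Qed.

Lemma cp_cone_cone : is_cone K -> is_cone (cp_cone dot K).
Proof.
move=> Kcone a _ a0 [k [b [k1 Kb ->]]].
exists k, (fun i => Num.sqrt a *: b i); split=> //.
  by move=> i; apply: Kcone => //; exact: sqrtr_ge0.
rewrite scaler_sumr; apply: eq_bigr => i _.
by rewrite tensor_squareZ sqr_sqrtr.
Qed.

Lemma cp_cone_tensor x : K x -> cp_cone dot K (tensor_square dot x).
Proof. by move=> Kx; exists 1%N, (fun=> x); split=> //; rewrite big_ord1. Qed.

End CompletelyPositive.

(** * A non-exposed face *)


Lemma cone_of_squares_cone (R : realType) (E : euclidean_jordan_algebra R) :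
  is_cone (cone_of_squares E).
Proof.
move=> a _ a0 [w _ <-]; exists (Num.sqrt a *: w) => //.
by rewrite jmulZl jmulZr scalerA -expr2 sqr_sqrtr.
Qed.

Section PeirceBlock.
Variables (R : realType) (E : euclidean_jordan_algebra R).
Variables (dot : inner_product E).
Hypothesis hdot : associative_form (jmul : E -> E -> E) dot.
Local Notation "x ** y" := (jmul x y) (at level 40, left associativity).
Variables (c1 c2 c3 c4 u : E).
Hypotheses (c11 : c1 ** c1 = c1) (c22 : c2 ** c2 = c2).
Hypotheses (c33 : c3 ** c3 = c3) (c44 : c4 ** c4 = c4).
Hypotheses (c12 : c1 ** c2 = 0) (c13 : c1 ** c3 = 0) (c14 : c1 ** c4 = 0).
Hypotheses (c23 : c2 ** c3 = 0) (c24 : c2 ** c4 = 0) (c34 : c3 ** c4 = 0).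
Hypotheses (hu : peirce_half c1 c2 u) (uu : u ** u = c1 + c2).
Implicit Types (s v x y z : R).

Let c1u : c1 ** u = 2^-1 *: u. Proof. by case: hu => /halfE. Qed.
Let c2u : c2 ** u = 2^-1 *: u. Proof. by case: hu => _ /halfE. Qed.
Let c3u : c3 ** u = 0.
Proof. exact: (orthogonal_peirce_half c11 c22 c33 c12 c13 c23 hu). Qed.
Let c4u : c4 ** u = 0.
Proof. exact: (orthogonal_peirce_half c11 c22 c44 c12 c14 c24 hu). Qed.

Let table := (c11, c22, c33, c44, uu, (c12, c13, c14, c23, c24, c34),
  (c1u, c2u, c3u, c4u), (jmulC c2 c1, jmulC c3 c1, jmulC c3 c2),
  (jmulC c4 c1, jmulC c4 c2, jmulC c4 c3),
  (jmulC u c1, jmulC u c2, jmulC u c3, jmulC u c4)).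

(** An element of the subalgebra Sym_2(R) x R x R: the matrix with diagonal
    [s], [x] and off-diagonal entry [v], followed by the scalars [y] and [z]. *)
Definition block s v x y z : E :=
  s *: c1 + v *: u + x *: c2 + y *: c3 + z *: c4.

Lemma block_sqr s v x y z : block s v x y z ** block s v x y z =
  block (s ^+ 2 + v ^+ 2) (v * (s + x)) (x ^+ 2 + v ^+ 2) (y ^+ 2) (z ^+ 2).
Proof.
apply: (dot_inj (dot := dot)) => t.
by rewrite /block !jmulE !table !(jmulE, dotE); lra.
Qed.

(** The square root of a positive semidefinite 2 x 2 matrix [X] is
    [(X + d I) / r] with [d = sqrt (det X)] and [r = sqrt (tr X + 2 d)]. *)
Lemma block_square s v x y z : 0 <= s -> 0 <= x -> v ^+ 2 <= s * x ->
  0 <= y -> 0 <= z -> cone_of_squares E (block s v x y z).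
Proof.
move=> s0 x0 vsx y0 z0; pose d := Num.sqrt (s * x - v ^+ 2).
have d0 : 0 <= d by exact: sqrtr_ge0.
have dd : d ^+ 2 = s * x - v ^+ 2 by rewrite sqr_sqrtr// subr_ge0.
suff [al [be [ga [h1 h2 h3]]]] : exists al be ga, [/\ al ^+ 2 + ga ^+ 2 = s,
    ga * (al + be) = v & be ^+ 2 + ga ^+ 2 = x].
  exists (block al ga be (Num.sqrt y) (Num.sqrt z)) => //.
  by rewrite block_sqr h1 h2 h3 !sqr_sqrtr.
pose r := Num.sqrt (s + x + 2 * d).
have rr : r ^+ 2 = s + x + 2 * d by rewrite sqr_sqrtr//; lra.
have [r0|r0] := eqVneq r 0.
  have [s00 x00] : s = 0 /\ x = 0 by move: rr; rewrite r0; split; lra.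
  have v00 : v = 0 by apply/eqP; rewrite -sqrf_eq0 eq_le sqr_ge0 andbT; nra.
  by exists 0, 0, 0; rewrite s00 x00 v00; split; ring.
have r20 : r ^+ 2 != 0 by rewrite sqrf_eq0.
exists ((s + d) / r), ((x + d) / r), (v / r); split.
- apply: (mulIf r20).
  transitivity ((s + d) ^+ 2 + v ^+ 2); first by field.
  by rewrite rr; nra.
- apply: (mulIf r20); transitivity (v * (s + x + 2 * d)); first by field.
  by rewrite rr.
- apply: (mulIf r20).
  transitivity ((x + d) ^+ 2 + v ^+ 2); first by field.
  by rewrite rr; nra.
Qed.

Lemma block_rank1 t : block 1 t (t ^+ 2) 0 0 ** block 1 t (t ^+ 2) 0 0 =
  (1 + t ^+ 2) *: block 1 t (t ^+ 2) 0 0.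
Proof.
rewrite block_sqr; apply: (dot_inj (dot := dot)) => w.
by rewrite /block !dotE; ring.
Qed.

Let dot_u1 : dot c1 u = 0.
Proof. by case: hu => _ <-; rewrite dotZr -hdot c12 dot0l mulr0. Qed.
Let dot_u2 : dot c2 u = 0.
Proof. by case: hu => <- _; rewrite dotZr -hdot (jmulC c2) c12 dot0l mulr0. Qed.
Let dot_u3 : dot c3 u = 0.
Proof. by case: hu => <- _; rewrite dotZr -hdot (jmulC c3) c13 dot0l mulr0. Qed.
Let dot_u4 : dot c4 u = 0.
Proof. by case: hu => <- _; rewrite dotZr -hdot (jmulC c4) c14 dot0l mulr0. Qed.
Let dot0 e f : e ** e = e -> e ** f = 0 -> dot e f = 0.
Proof. by move=> ee ef; rewrite -ee hdot ef dot0r. Qed.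

Let n := dot c1 c1.
Let n_u : dot u u = 2 * n.
Proof.
have : dot (u ** u) c1 = n.
  by rewrite uu dotDl (dotC dot c2) (dot0 c11 c12) addr0.
by rewrite hdot (jmulC u) c1u dotZr => <-; lra.
Qed.
Let n_2 : dot c2 c2 = n.
Proof.
have : dot (u ** u) c2 = dot c2 c2 by rewrite uu dotDl (dot0 c11 c12) add0r.
by rewrite hdot (jmulC u) c2u dotZr n_u => <-; lra.
Qed.

Lemma dot_block s v x y z b : dot (block s v x y z) b =
  s * dot c1 b + v * dot u b + x * dot c2 b + y * dot c3 b + z * dot c4 b.
Proof. by rewrite /block !dotE. Qed.

Let pairing := (dot_u1, dot_u2, dot_u3, dot_u4, n_u, n_2,
  (dot0 c11 c12, dot0 c11 c13, dot0 c11 c14, dot0 c22 c23, dot0 c22 c24),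
  dot0 c33 c34, (dotC dot c2 c1, dotC dot c3 c1, dotC dot c4 c1),
  (dotC dot c3 c2, dotC dot c4 c2, dotC dot c4 c3),
  (dotC dot u c1, dotC dot u c2, dotC dot u c3, dotC dot u c4)).

Hypotheses (u0 : u <> 0) (c30 : c3 <> 0) (c40 : c4 <> 0).

Let n0 : 0 < n.
Proof. by have := dot_gt0 dot u0; rewrite n_u; lra. Qed.

(** Coordinates of the orthogonal projection of [b] to the span of the blocks. *)
Definition coord_s b := dot c1 b / dot c1 c1.
Definition coord_v b := dot u b / dot u u.
Definition coord_x b := dot c2 b / dot c2 c2.
Definition coord_y b := dot c3 b / dot c3 c3.
Definition coord_z b := dot c4 b / dot c4 c4.

Lemma coord_block s v x y z (b := block s v x y z) :
  [/\ coord_s b = s, coord_v b = v, coord_x b = x, coord_y b = y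
    & coord_z b = z].
Proof.
have n3 := dot_gt0 dot c30; have n4 := dot_gt0 dot c40.
rewrite /coord_s /coord_v /coord_x /coord_y /coord_z /b /block.
by split; rewrite !dotE !pairing; field; rewrite ?gt_eqF.
Qed.

(** Where [coord_y] vanishes this is [(z + x - s)^2 + 4 z (s - 4 v + 4 x)], and
    where [coord_x] and [coord_v] vanish it is [(s - y + z)^2]; the two agree on
    the intersection.  The factor [s - 4 v + 4 x] is the pairing with the matrix
    [[1, -2], [-2, 4]] of rank one. *)
Definition witness_form b :=
  (coord_z b + coord_x b - coord_s b) ^+ 2
  + 4 * coord_z b * (coord_s b - 4 * coord_v b + 4 * coord_x b)
  + coord_y b ^+ 2 - 2 * coord_y b * (coord_s b + coord_z b).

Lemma coord_square_ge0 b : cone_of_squares E b ->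
  [/\ 0 <= coord_s b, 0 <= coord_x b, 0 <= coord_y b, 0 <= coord_z b &
      forall t, 0 <= coord_s b + 2 * t * coord_v b + t ^+ 2 * coord_x b].
Proof.
case=> w _ <-.
have pos e : e ** e = e -> 0 <= dot e (w ** w) / dot e e.
  by move=> ee; rewrite divr_ge0 ?dot_ge0// (dot_idempotent_square_ge0 hdot).
split; [exact: pos|exact: pos|exact: pos|exact: pos|move=> t].
have : 0 <= dot (block 1 t (t ^+ 2) 0 0) (w ** w).
  apply: (dot_square_ge0 hdot (a := 1 + t ^+ 2)); last exact: block_rank1.
  by rewrite ltr_pwDl// sqr_ge0.
rewrite dot_block /coord_s /coord_v /coord_x n_u n_2 -/n => h.
rewrite -(pmulr_rge0 _ n0); apply: le_trans h _; rewrite le_eqVlt.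
by apply/orP; left; apply/eqP; field; rewrite gt_eqF.
Qed.

Lemma witness_form_ge0 b : cone_of_squares E b ->
  coord_y b * coord_x b = 0 -> 0 <= witness_form b.
Proof.
move=> /coord_square_ge0[s0 x0 y0 z0 h] /eqP; rewrite mulf_eq0 /witness_form.
case/orP => /eqP h0; rewrite h0.
  have := h (- 2) => h2; have := sqr_ge0 (coord_z b + coord_x b - coord_s b).
  by have := mulr_ge0 z0 (_ : 0 <= coord_s b - 4 * coord_v b + 4 * coord_x b);
    lra.
have v0 : coord_v b = 0.
  apply/eqP/negP => /negP v0.
  have := h (- (coord_s b + 1) / (2 * coord_v b)); rewrite h0 mulr0 addr0.
  have -> : 2 * (- (coord_s b + 1) / (2 * coord_v b)) * coord_v b =
    - (coord_s b + 1) by field.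
  by lra.
rewrite v0; have := sqr_ge0 (coord_s b - coord_y b + coord_z b); lra.
Qed.

(** Common zeros of [witness_form] and of the product [coord_y * coord_x].  The
    first two satisfy [z = x - s = 0], the next three [s - y + z = x = 0]; in the
    last one [z + x - s = 0] and the matrix [[4, 2], [2, 1]] is orthogonal to
    [[1, -2], [-2, 4]]. *)
Let witness_rays : seq E := [:: block 1 0 1 0 0; block 1 1 1 0 0;
  block 1 0 0 1 0; block 0 0 0 1 1; block 1 0 0 2 1; block 4 2 1 0 3].

Definition witness : 'End(E) := \sum_(b <- witness_rays) tensor_square dot b.

Lemma witness_rays_square b : b \in witness_rays -> cone_of_squares E b.
Proof.
rewrite !inE => /or4P[|||/or3P[]] /eqP ->; apply: block_square; lra.
Qed.

Lemma witness_cp : cp_cone dot (cone_of_squares E) witness.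
Proof.
rewrite /witness; have := witness_rays_square.
have : witness_rays != [::] by [].
elim: witness_rays => // b [|b' r] IH _ H.
  by rewrite big_seq1; apply/cp_cone_tensor/H; rewrite inE eqxx.
rewrite big_cons; apply: cp_cone_add.
  by apply/cp_cone_tensor/H; rewrite inE eqxx.
by apply: IH => // d dr; apply: H; rewrite inE dr orbT.
Qed.

Lemma witness_rays_witness_form0 b : b \in witness_rays ->
  witness_form b = 0 /\ coord_y b * coord_x b = 0.
Proof.
have H s v x y z : witness_form (block s v x y z) = (z + x - s) ^+ 2
    + 4 * z * (s - 4 * v + 4 * x) + y ^+ 2 - 2 * y * (s + z) /\
    coord_y (block s v x y z) * coord_x (block s v x y z) = y * x.
  by rewrite /witness_form; case: (coord_block s v x y z) => -> -> -> -> ->.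
by rewrite !inE => /or4P[|||/or3P[]] /eqP ->; rewrite !(H _ _ _ _ _).1
  !(H _ _ _ _ _).2; split; ring.
Qed.

(** Extends the product of the coordinates dual to [p] and [q] from tensor squares
    to a linear functional on operators. *)
Let pair (T : 'End(E)) (p q : E) := dot p (T q) / dot p p / dot q q.

Let pair_tensor b p q : pair (tensor_square dot b) p q =
  (dot p b / dot p p) * (dot q b / dot q q).
Proof. by rewrite /pair tensor_squareE dotZr (dotC dot b q) -!mulrA; ring. Qed.

Let combine (m : E -> E -> R) := m c4 c4 + m c2 c2 + m c1 c1 + m c3 c3
  + 18 * m c4 c2 + 2 * m c4 c1 - 2 * m c2 c1 - 16 * m c4 u - 2 * m c3 c1
  - 2 * m c3 c4.

Let sum_witness_form (I : Type) (r : seq I) (f : I -> E) :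
  \sum_(i <- r) witness_form (f i) =
  combine (fun p q => \sum_(i <- r) pair (tensor_square dot (f i)) p q).
Proof.
rewrite /combine !mulr_sumr -!sumrN -!big_split; apply: eq_bigr => i _ /=.
rewrite !pair_tensor /witness_form /coord_s /coord_v /coord_x /coord_y /coord_z.
by ring.
Qed.

(** Each term [b] of a decomposition satisfies [coord_y b * coord_x b = 0], so
    [witness_form] is nonnegative on it, while the sum over the terms is [- e]. *)
Lemma witness_extremal e : 0 < e ->
  ~ cp_cone dot (cone_of_squares E) (witness - e *: tensor_square dot c3).
Proof.
move=> e0 [k [b [_ Kb wE]]].
have pair_lin T p q : pair (witness - e *: T) p q =
    \sum_(b <- witness_rays) pair (tensor_square dot b) p q - e * pair T p q.
  rewrite /pair; rewrite lfunE /= lfunE /= lfunE /= dotDr dotNr dotZr.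
  rewrite /witness sum_lfunE dot_sumr !mulrBl !mulr_suml; ring.
have pair_sum p q : pair (\sum_(i < k) tensor_square dot (b i)) p q =
    \sum_(i < k) pair (tensor_square dot (b i)) p q.
  by rewrite /pair sum_lfunE dot_sumr !mulr_suml.
have key p q : \sum_(i < k) pair (tensor_square dot (b i)) p q =
    \sum_(b <- witness_rays) pair (tensor_square dot b) p q
    - e * pair (tensor_square dot c3) p q by rewrite -pair_sum -wE pair_lin.
have yx0 i : coord_y (b i) * coord_x (b i) = 0.
  have yx_ge0 j : true -> 0 <= coord_y (b j) * coord_x (b j).
    by move=> _; have [] := coord_square_ge0 (Kb j); move=> *; rewrite mulr_ge0.
  have := key c3 c2; under eq_bigr do rewrite pair_tensor.
  have -> : \sum_(b <- witness_rays) pair (tensor_square dot b) c3 c2 = 0.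
    rewrite big_seq big1// => a aw.
    by rewrite pair_tensor (witness_rays_witness_form0 aw).2.
  rewrite pair_tensor (dot0 c22 c23) mul0r mulr0 mulr0 subr0.
  by move/(psumr_eq0P yx_ge0) => ->.
have : 0 <= \sum_(i < k) witness_form (b i).
  by apply: sumr_ge0 => i _; exact: witness_form_ge0.
have -> : \sum_(i < k) witness_form (b i) = - e.
  have rays0 : \sum_(b <- witness_rays) witness_form b = 0.
    by rewrite big_seq big1// => a /witness_rays_witness_form0[].
  have c31 : \sum_(b <- [:: block 0 0 0 1 0]) witness_form b = 1.
    rewrite big_seq1 /witness_form.
    by case: (coord_block 0 0 0 1 0) => -> -> -> -> ->; ring.
  move: rays0 (congr1 ( *%R e) c31).
  rewrite !sum_witness_form /combine !big_seq1 !key.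
  rewrite /block !scale0r scale1r !add0r addr0; lra.
by rewrite oppr_ge0 leNgt e0.
Qed.

(** An operator exposing the face generated by [witness] defines a copositive form
    that vanishes at the six rays, hence at [c3]; so the face would contain the
    tensor square of [c3]. *)
Lemma block_not_facially_exposed : ~ facially_exposed (selfadjoint dot)
  (@trace_form R E) (cp_cone dot (cone_of_squares E)).
Proof.
set C := cp_cone _ _ => exposed.
have Ccone : is_cone C by apply: cp_cone_cone; exact: cone_of_squares_cone.
have Cadd : add_closed_set C by exact: cp_cone_add.
have [D [Dself Dge0] FE] :=
  exposed _ (generated_face_face Cadd Ccone witness_cp).
have Dsq b : cone_of_squares E b -> 0 <= dot b (D b).
  by move=> Kb; rewrite -trace_form_tensor; apply: Dge0; exact: cp_cone_tensor.
have Dw : trace_form witness D = 0.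
  have : generated_face C witness witness.
    split; first exact: witness_cp.
    by exists 1 => //; rewrite scale1r subrr -(scale0r witness);
      apply: Ccone => //; exact: witness_cp.
  by rewrite FE => -[].
have Drays b : b \in witness_rays -> dot b (D b) = 0.
  move: Dw; rewrite /witness trace_form_suml big_seq.
  under eq_bigr do rewrite trace_form_tensor.
  move=> sum0 bw; move/eqP: sum0; rewrite psumr_eq0 => [/allP/(_ b bw)|a aw].
    by rewrite bw => /eqP.
  exact: Dsq (witness_rays_square aw).
have Dsym p q : dot p (D q) = dot q (D p) by rewrite dotC Dself.
have Dblock s v x y z (b := block s v x y z) : dot b (D b) =
    dot c1 (D c1) * s ^+ 2 + dot u (D u) * v ^+ 2 + dot c2 (D c2) * x ^+ 2
    + dot c3 (D c3) * y ^+ 2 + dot c4 (D c4) * z ^+ 2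
    + 2 * (dot c1 (D u) * s * v + dot c1 (D c2) * s * x + dot c1 (D c3) * s * y
    + dot c1 (D c4) * s * z + dot u (D c2) * v * x + dot u (D c3) * v * y
    + dot u (D c4) * v * z + dot c2 (D c3) * x * y + dot c2 (D c4) * x * z
    + dot c3 (D c4) * y * z).
  rewrite /b /block !linearD /= !linearZ /= !dotE (Dsym u c1) !(Dsym c2 c1)
    !(Dsym c3 c1) !(Dsym c4 c1) (Dsym c2 u) (Dsym c3 u) (Dsym c4 u)
    (Dsym c3 c2) (Dsym c4 c2) (Dsym c4 c3); ring.
have D33 : dot c3 (D c3) = 0.
  apply: (@copositive_forced_zero _ (dot c1 (D c1)) (dot u (D u))
      (dot c2 (D c2)) (dot c3 (D c3)) (dot c4 (D c4)) (dot c1 (D u))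
      (dot c1 (D c2)) (dot c1 (D c3)) (dot c1 (D c4)) (dot u (D c2))
      (dot u (D c3)) (dot u (D c4)) (dot c2 (D c3)) (dot c2 (D c4))
      (dot c3 (D c4))) => [s v x y z s0 x0 vsx y0 z0|||||| ];
    rewrite -Dblock; try by apply: Drays; rewrite !inE eqxx ?orbT.
  exact: Dsq (block_square s0 x0 vsx y0 z0).
have c3C : C (tensor_square dot c3).
  by apply: cp_cone_tensor; exists c3.
have : generated_face C witness (tensor_square dot c3).
  by rewrite FE; split=> //=; rewrite trace_form_tensor.
by case=> _ [e e0 /(witness_extremal e0)].
Qed.

End PeirceBlock.

(** * The two kinds of Jordan frames *)


Section FrameAlternative.
Variables (R : realType) (E : euclidean_jordan_algebra R).
Variables (dot : inner_product E).
Hypothesis hdot : associative_form (jmul : E -> E -> E) dot.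
Local Notation "x ** y" := (jmul x y) (at level 40, left associativity).

(** Scales [u] to a square root of [c i + c j] and takes the two remaining members
    of the frame for [c3] and [c4]. *)
Lemma frame_half_not_facially_exposed (c : 'I_4 -> E) i j u :
  jordan_frame c -> i != j -> u <> 0 -> peirce_half (c i) (c j) u ->
  ~ facially_exposed (selfadjoint dot) (@trace_form R E)
      (cp_cone dot (cone_of_squares E)).
Proof.
case=> prim orth _ ij u0 hu.
have /cards2P[k [l [kl kl_ij]]] : #|~: [set i; j]%SET| == 2.
  by rewrite cardsCs finset.setCK cards2 ij card_ord.
have /norP[ki kj] : ~~ ((k == i) || (k == j)).
  have : k \in (~: [set i; j])%SET by rewrite kl_ij finset.set21.
  by rewrite finset.in_setC finset.in_set2.
have /norP[li lj] : ~~ ((l == i) || (l == j)).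
  have : l \in (~: [set i; j])%SET by rewrite kl_ij finset.set22.
  by rewrite finset.in_setC finset.in_set2.
have cc m : c m ** c m = c m by case: (prim m).
have c0 m : c m <> 0 by case: (prim m).
have [a a0 uu] := peirce_half_square (prim i) (prim j) (orth i j ij) u0 hu.
pose v := (Num.sqrt a)^-1 *: u.
have sa0 : Num.sqrt a != 0 by rewrite sqrtr_eq0 -ltNge.
have v0 : v <> 0.
  by apply/eqP; rewrite scaler_eq0 negb_or invr_eq0 sa0; apply/eqP.
have hv : peirce_half (c i) (c j) v.
  by case: hu => hi hj; split; rewrite jmulZr scalerA mulrC -scalerA ?hi ?hj.
have vv : v ** v = c i + c j.
  rewrite jmulZl jmulZr uu !scalerA -expr2 exprVn sqr_sqrtr ?ltW//.
  by rewrite mulVf ?scale1r// gt_eqF.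
apply: (block_not_facially_exposed hdot (c1 := c i) (c2 := c j) (c3 := c k)
  (c4 := c l) (u := v)) => //; apply: orth; by rewrite // eq_sym.
Qed.

Lemma diagonal_hadamard r (c : 'I_r -> E) : jordan_frame c ->
  (forall x, exists a : 'I_r -> R, x = \sum_i a i *: c i) ->
  jordan_isomorphic E (hadamard_eja R r).
Proof.
case=> prim orth one diag.
have cc i : c i ** c i = c i by case: (prim i).
have n0 i : dot (c i) (c i) != 0.
  by case: (prim i) => _ /(dot_gt0 dot)/gt_eqF ->.
have dot0 i j : i != j -> dot (c i) (c j) = 0.
  by move=> ij; rewrite -(cc i) hdot orth// dot0r.
pose f (x : E) : hadamard_eja R r := \row_i (dot (c i) x / dot (c i) (c i)).
have flin : linear f.
  by move=> a x y; apply/rowP => i; rewrite !mxE dotDr dotZr mulrDl mulrA.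
pose L := GRing.isLinear.Build _ _ _ _ f flin.
pose F : {linear E -> hadamard_eja R r} := HB.pack f L.
have fsum (a : 'I_r -> R) : f (\sum_i a i *: c i) = \row_i a i.
  apply/rowP => i; rewrite !mxE dot_sumr (bigD1 i)//= big1 => [|j ji].
    by rewrite addr0 dotZr mulfK.
  by rewrite dotZr dot0 ?mulr0// eq_sym.
exists F; split.
  exists (fun v : 'rV[R]_r => \sum_i v 0 i *: c i) => x /=.
    have [a ->] := diag x; rewrite fsum; apply: eq_bigr => i _.
    by rewrite mxE.
  by rewrite fsum; apply/rowP => i; rewrite mxE.
move=> x y /=; have [a ->] := diag x; have [b ->] := diag y.
have -> : (\sum_i a i *: c i) ** (\sum_i b i *: c i) =
    \sum_i (a i * b i) *: c i.
  rewrite jmul_suml; apply: eq_bigr => i _; rewrite linear_sumr (bigD1 i)//=.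
  rewrite big1 => [|j ji]; first by rewrite addr0 !jmulE cc scalerA.
  by rewrite !jmulE orth ?scaler0// eq_sym.
by rewrite !fsum; apply/rowP => i; rewrite !mxE.
Qed.

End FrameAlternative.

(** * Doubly nonnegative matrices *)


Section PositiveSemidefinite.
Variables (R : realType) (n : nat).
Implicit Types (A B : 'M[R]_n) (x y b : 'rV[R]_n).

Definition qform A x y : R := (x *m A *m y^T) 0 0.

Lemma qformDl A x y z : qform A (x + y) z = qform A x z + qform A y z.
Proof. by rewrite /qform !mulmxDl mxE. Qed.

Lemma qformZl A a x y : qform A (a *: x) y = a * qform A x y.
Proof. by rewrite /qform -!scalemxAl mxE. Qed.

Lemma qformDm A B x y : qform (A + B) x y = qform A x y + qform B x y.
Proof. by rewrite /qform mulmxDr mulmxDl mxE. Qed.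

Lemma qformZm A a x y : qform (a *: A) x y = a * qform A x y.
Proof. by rewrite /qform -scalemxAr -scalemxAl mxE. Qed.

Lemma qform_sym A x y : A^T = A -> qform A x y = qform A y x.
Proof.
move=> sA; transitivity ((x *m A *m y^T)^T 0 0); first by rewrite [RHS]mxE.
by rewrite !trmx_mul trmxK sA mulmxA.
Qed.

Lemma qform_rank1 b x y :
  qform (b^T *m b) x y = (b *m x^T) 0 0 * (b *m y^T) 0 0.
Proof.
rewrite /qform mulmxA -mulmxA mxE big_ord1; congr (_ * _).
transitivity ((x *m b^T)^T 0 0); first by rewrite [RHS]mxE.
by rewrite trmx_mul trmxK.
Qed.

Lemma qformE A x y : qform A x y = \sum_i \sum_j x 0 i * A i j * y 0 j.
Proof.
rewrite /qform mxE exchange_big /=; apply: eq_bigr => j _.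
by rewrite !mxE mulr_suml; apply: eq_bigr => i _.
Qed.

Definition psd A := A^T = A /\ forall x, 0 <= qform A x x.

Lemma psd_cauchy_schwarz A x y : psd A ->
  qform A x y ^+ 2 <= qform A x x * qform A y y.
Proof.
case=> sA A0; have H t :
    0 <= t ^+ 2 * qform A x x + 2 * t * qform A x y + qform A y y.
  have := A0 (t *: x + y); rewrite !(qformDl, qformZl).
  rewrite ![qform A _ (_ + _)]qform_sym//.
  rewrite !(qformDl, qformZl) (qform_sym y x sA); lra.
have [x0|x0] := eqVneq (qform A x x) 0.
  suff -> : qform A x y = 0 by rewrite x0 expr0n mul0r.
  apply/eqP/negP => /negP b0.
  have := H (- (qform A y y + 1) / (2 * qform A x y)); rewrite x0 mulr0 add0r.
  have -> : 2 * (- (qform A y y + 1) / (2 * qform A x y)) * qform A x y =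
    - (qform A y y + 1) by field.
  lra.
have xp : 0 < qform A x x by rewrite lt_def x0 A0.
have := mulr_ge0 (ltW xp) (H (- qform A x y / qform A x x)) => h.
rewrite -subr_ge0; apply: le_trans h _.
by rewrite le_eqVlt; apply/orP; left; apply/eqP; field.
Qed.

Lemma qform_delta A x i : qform A x (delta_mx 0 i) = (x *m A) 0 i.
Proof. by rewrite /qform trmx_delta -colE mxE. Qed.

Lemma psd_ker A x : psd A -> qform A x x = 0 -> x *m A = 0.
Proof.
move=> pA x0; apply/rowP => i; rewrite -qform_delta mxE.
have := psd_cauchy_schwarz x (delta_mx 0 i) pA; rewrite x0 mul0r => h.
by apply/eqP; rewrite -sqrf_eq0 eq_le h sqr_ge0.
Qed.

(** By the Cauchy-Schwarz inequality for the form of [A], the square of [x A y^T]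
    is at most [x A x^T] times [y A y^T]. *)
Lemma psd_sub_rank1 A x (a : R) : psd A -> 0 <= a -> a * qform A x x <= 1 ->
  psd (A - a *: ((x *m A)^T *m (x *m A))).
Proof.
move=> pA a0 ax; have [sA A0] := pA; split.
  by rewrite linearB linearZ /= trmx_mul trmxK sA.
move=> y; rewrite -scaleNr qformDm qformZm qform_rank1 mulNr subr_ge0 -expr2.
rewrite -/(qform A x y).
apply: (le_trans (ler_wpM2l a0 (psd_cauchy_schwarz x y pA))).
by rewrite mulrA ler_piMl.
Qed.

Definition dnn A := psd A /\ forall i j, 0 <= A i j.

Definition cpmx A := exists (k : nat) (b : 'I_k -> 'rV[R]_n),
  (forall i j, 0 <= b i 0 j) /\ A = \sum_(i < k) (b i)^T *m b i.

Lemma cpmxD A B : cpmx A -> cpmx B -> cpmx (A + B).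
Proof.
move=> [k [a [a0 ->]]] [l [b [b0 ->]]].
exists (k + l)%N, (fun i => match split i with inl j => a j | inr j => b j end).
split; first by move=> i; case: split => j.
rewrite big_split_ord; congr (_ + _); apply: eq_bigr => i _.
  by rewrite (unsplitK (inl i)).
by rewrite (unsplitK (inr i)).
Qed.

Lemma cpmx0 : cpmx 0.
Proof.
exists 0%N, (fun=> 0); split; last by rewrite big_ord0.
by move=> i j; rewrite mxE.
Qed.

Lemma cpmx_rank1 a b :
  0 <= a -> (forall j, 0 <= b 0 j) -> cpmx (a *: (b^T *m b)).
Proof.
move=> a0 b0; exists 1%N, (fun=> Num.sqrt a *: b); split.
  by move=> _ j; rewrite mxE mulr_ge0// sqrtr_ge0.
rewrite big_ord1 [(_ *: b)^T]linearZ /= -scalemxAl -scalemxAr scalerA -expr2.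
by rewrite sqr_sqrtr.
Qed.

Lemma dnn_sub_rank1 A x (a : R) (b := x *m A) : dnn A -> 0 <= a ->
  a * qform A x x <= 1 -> (forall j k, a * (b 0 j * b 0 k) <= A j k) ->
  dnn (A - a *: (b^T *m b)).
Proof.
move=> [pA A0] a0 ax ab; split; first exact: psd_sub_rank1.
move=> j k; rewrite !mxE big_ord1 !mxE subr_ge0.
by have := ab j k; rewrite /b !mxE.
Qed.

Lemma dnn_diag0 A i j : dnn A -> A i i = 0 -> A i j = 0.
Proof.
move=> [pA _] ii; have : (delta_mx 0 i : 'rV_n) *m A = 0.
  by apply: psd_ker => //; rewrite qform_delta -rowE mxE.
by move/rowP/(_ j); rewrite -rowE !mxE.
Qed.

End PositiveSemidefinite.

(** * Four-cycles *)


Section FourByFour.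
Variable R : realType.
Implicit Types (A : 'M[R]_4) (x b w : 'rV[R]_4).

(** The four indices are the vertices of a cycle in which [i] is opposite to [l]
    and [j] is opposite to [k]. *)
Section FourCycle.
Variables i j k l : 'I_4.
Hypothesis ijkl : uniq [:: i; j; k; l].

Lemma ord4_cover (x : 'I_4) : [\/ x = i, x = j, x = k | x = l].
Proof.
have : x \in [:: i; j; k; l].
  have [//|_ ->] := uniq_min_size ijkl (fun y _ => mem_enum 'I_4 y).
    by rewrite size_enum_ord.
  exact: mem_enum.
rewrite !inE => /or4P[] /eqP ->.
- by constructor 1.
- by constructor 2.
- by constructor 3.
- by constructor 4.
Qed.

Lemma sum_ord4 (F : 'I_4 -> R) : \sum_x F x = F i + F j + F k + F l.
Proof.
have p : perm_eq (index_enum 'I_4) [:: i; j; k; l].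
  rewrite perm_sym; apply: uniq_perm => //; first exact: index_enum_uniq.
  move=> x; rewrite mem_index_enum !inE.
  by case: (ord4_cover x) => ->; rewrite eqxx ?orbT.
by rewrite (perm_big _ p) /= !big_cons big_nil /= addr0 !addrA.
Qed.

(** Supported on the edge between [p] and [q], with entries swapped so that a
    multiple of its tensor square has the given off-diagonal entry and diagonal
    entries in the ratio of [w 0 q] to [w 0 p] and its inverse. *)
Definition edge_vector w (p q : 'I_4) : 'rV[R]_4 :=
  w 0 q *: delta_mx 0 p + w 0 p *: delta_mx 0 q.

(** A four-cycle is bipartite: with [W] the vector of absolute values of [x],
    changing the signs of [W] at [j] and [k] makes all mixed terms of the form
    nonpositive, so the form is at most its value 0 at [x], and the vector so
    obtained lies in the kernel.  The kernel equations express each diagonal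
    entry of [A] through the two edges at that vertex, and then say that [A] is a
    sum of four tensor squares, one for each edge. *)
Lemma four_cycle_singular_cp A x : psd A -> A i l = 0 -> A j k = 0 ->
  0 < A i j -> 0 < A i k -> 0 < A j l -> 0 < A k l ->
  x != 0 -> x *m A = 0 -> cpmx A.
Proof.
move=> [sA A0] il jk ij ik jl kl x0 xA.
have S p q : A q p = A p q by rewrite -{1}sA mxE.
have neqs : [/\ i != j, i != k & i != l] /\
    [/\ j != k, j != l & k != l].
  move: ijkl; rewrite /= !inE !negb_or andbT.
  by move=> /and3P[/and3P[-> -> ->] /andP[-> ->] ->].
have [[nij nik nil] [njk njl nkl]] := neqs.
pose v : 'rV[R]_4 :=
  \row_p (if (p == i) || (p == l) then `|x 0 p| else - `|x 0 p|).
have [vi vj vk vl] : [/\ v 0 i = `|x 0 i|, v 0 j = - `|x 0 j|,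
    v 0 k = - `|x 0 k| & v 0 l = `|x 0 l|].
  by rewrite !mxE !eqxx orbT !(eq_sym _ i) !(eq_sym k l) (negPf nij) (negPf nik)
    (negPf njl) (eq_sym l k) (negPf nkl).
have vA : v *m A = 0.
  apply: psd_ker => //; apply/eqP; rewrite eq_le A0 andbT.
  have : qform A x x = 0 by rewrite /qform xA mul0mx mxE.
  rewrite !qformE !sum_ord4 vi vj vk vl !(S i l) !(S j k) !il !jk.
  rewrite (S i j) (S i k) (S j l) (S k l).
  have ab (p q : R) : - (`|p| * `|q|) <= p * q by rewrite -normrM lerNnormlW.
  have aa (p : R) : `|p| * `|p| = p * p.
    by rewrite -expr2 -normrX ger0_norm ?sqr_ge0.
  have := ler_wpM2l (ltW ij) (ab (x 0 i) (x 0 j)).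
  have := ler_wpM2l (ltW ik) (ab (x 0 i) (x 0 k)).
  have := ler_wpM2l (ltW jl) (ab (x 0 j) (x 0 l)).
  have := ler_wpM2l (ltW kl) (ab (x 0 k) (x 0 l)).
  have := congr1 ( *%R (A i i)) (aa (x 0 i)).
  have := congr1 ( *%R (A j j)) (aa (x 0 j)).
  have := congr1 ( *%R (A k k)) (aa (x 0 k)).
  have := congr1 ( *%R (A l l)) (aa (x 0 l)).
  lra.
have row p : \sum_q v 0 q * A q p = 0 by move/rowP/(_ p): vA; rewrite !mxE.
have := row i; have := row j; have := row k; have := row l.
rewrite !sum_ord4 vi vj vk vl !(S i l) !(S j k) !il !jk !(S i j) !(S i k)
  !(S j l) !(S k l) => rl rk rj ri {vi vj vk vl row vA v}.
have sum0 (p q y z : R) : 0 <= p -> 0 <= q -> 0 < y -> 0 < z ->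
    p * y + q * z = 0 -> p = 0 /\ q = 0.
  move=> p0 q0 y0 z0 pq; have py := mulr_ge0 p0 (ltW y0).
  have qz := mulr_ge0 q0 (ltW z0).
  have py0 : p * y = 0 by lra.
  have qz0 : q * z = 0 by lra.
  by split; [move/eqP: py0|move/eqP: qz0]; rewrite mulf_eq0 ?(gt_eqF y0)
    ?(gt_eqF z0) orbF => /eqP.
pose W : 'rV[R]_4 := \row_p `|x 0 p|.
have WE p : W 0 p = `|x 0 p| by rewrite mxE.
have Wge0 p : 0 <= W 0 p by rewrite WE.
move: rl rk rj ri; rewrite -!WE => rl rk rj ri.
have nall : ~ [/\ W 0 i = 0, W 0 j = 0, W 0 k = 0 & W 0 l = 0].
  case; rewrite !WE => /eqP wi /eqP wj /eqP wk /eqP wl; move/eqP: x0; apply.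
  move: wi wj wk wl; rewrite !normr_eq0 => /eqP wi /eqP wj /eqP wk /eqP wl.
  by apply/rowP => p; rewrite mxE; case: (ord4_cover p) => ->.
have zi : W 0 i = 0 -> W 0 j = 0 /\ W 0 k = 0.
  by move=> W0; rewrite W0 in ri; apply: (sum0 _ _ _ _ _ _ ij ik) => //; lra.
have zj : W 0 j = 0 -> W 0 i = 0 /\ W 0 l = 0.
  by move=> W0; rewrite W0 in rj; apply: (sum0 _ _ _ _ _ _ ij jl) => //; lra.
have zk : W 0 k = 0 -> W 0 i = 0 /\ W 0 l = 0.
  by move=> W0; rewrite W0 in rk; apply: (sum0 _ _ _ _ _ _ ik kl) => //; lra.
have zl : W 0 l = 0 -> W 0 j = 0 /\ W 0 k = 0.
  by move=> W0; rewrite W0 in rl; apply: (sum0 _ _ _ _ _ _ jl kl) => //; lra.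
have Wpos p : 0 < W 0 p.
  rewrite lt_def Wge0 andbT; apply/eqP => W0; apply: nall.
  case: (ord4_cover p) => pE; rewrite pE in W0.
  - by have [wj wk] := zi W0; have [_ wl] := zj wj.
  - by have [wi wl] := zj W0; have [_ wk] := zi wi.
  - by have [wi wl] := zk W0; have [wj _] := zi wi.
  - by have [wj wk] := zl W0; have [wi _] := zj wj.
pose e p q := (A p q / (W 0 p * W 0 q)) *:
  ((edge_vector W p q)^T *m edge_vector W p q).
have ecp p q : 0 <= A p q -> cpmx (e p q).
  move=> pq; apply: cpmx_rank1; first by rewrite divr_ge0// mulr_ge0.
  by move=> t; rewrite !mxE -!WE addr_ge0// mulr_ge0// ler0n.
have -> : A = e i j + e i k + e j l + e k l.
  have eE p q s t : e p q s t = A p q / (W 0 p * W 0 q) *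
      ((W 0 q * (s == p)%:R + W 0 p * (s == q)%:R) *
       (W 0 q * (t == p)%:R + W 0 p * (t == q)%:R)).
    by rewrite !mxE big_ord1 !mxE -!WE.
  have N := (negPf nij, negPf nik, negPf nil,
    (negPf njk, negPf njl, negPf nkl)).
  have C := (eq_sym j i, eq_sym k i, eq_sym l i,
    (eq_sym k j, eq_sym l j, eq_sym l k)).
  have F p := gt_eqF (Wpos p).
  have add4 (M1 M2 M3 M4 : 'M[R]_4) s t :
    (M1 + M2 + M3 + M4) s t = M1 s t + M2 s t + M3 s t + M4 s t by rewrite !mxE.
  have Aii : A i i = (W 0 j * A i j + W 0 k * A i k) / W 0 i.
    by apply: (mulIf (negbT (F i))); rewrite mulfVK ?F//; lra.
  have Ajj : A j j = (W 0 i * A i j + W 0 l * A j l) / W 0 j.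
    by apply: (mulIf (negbT (F j))); rewrite mulfVK ?F//; lra.
  have Akk : A k k = (W 0 i * A i k + W 0 l * A k l) / W 0 k.
    by apply: (mulIf (negbT (F k))); rewrite mulfVK ?F//; lra.
  have All : A l l = (W 0 j * A j l + W 0 k * A k l) / W 0 l.
    by apply: (mulIf (negbT (F l))); rewrite mulfVK ?F//; lra.
  apply/matrixP => s t; rewrite add4 !eE.
  case: (ord4_cover s) => ->; case: (ord4_cover t) => ->;
    rewrite ?eqxx ?C ?N /= ?(S i j) ?(S i k) ?(S i l) ?(S j k) ?(S j l) ?(S k l)
      ?il ?jk ?Aii ?Ajj ?Akk ?All; field; rewrite ?F//.
apply: cpmxD; last by apply: ecp; exact: ltW.
apply: cpmxD; last by apply: ecp; exact: ltW.
by apply: cpmxD; apply: ecp; exact: ltW.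
Qed.
End FourCycle.
End FourByFour.

(** * Doubly nonnegative matrices of order four *)


Section MaxfieldMinc.
Variable R : realType.

(** Subtracts the multiple of the matrix unit at [(i, i)] that makes [A] singular;
    this does not affect the pattern of the off-diagonal entries. *)
Lemma four_cycle_cp i j k l (A : 'M[R]_4) : uniq [:: i; j; k; l] -> dnn A ->
  A i l = 0 -> A j k = 0 -> 0 < A i j -> 0 < A i k -> 0 < A j l -> 0 < A k l ->
  cpmx A.
Proof.
move=> ijkl [pA A0] il jk ij ik jl kl.
have [uA|] := boolP (A \in unitmx); last first.
  rewrite -row_free_unit -kermx_eq0 => /rowV0Pn[x].
  rewrite sub_kermx => /eqP xA x0.
  exact: (four_cycle_singular_cp ijkl pA il jk ij ik jl kl x0 xA).
pose d : 'rV[R]_4 := delta_mx 0 i; pose x := d *m invmx A.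
have xA : x *m A = d by rewrite mulmxKV.
have d0 : d != 0.
  apply/eqP => /rowP/(_ i); rewrite !mxE !eqxx => /eqP.
  by rewrite oner_eq0.
have x0 : x != 0 by apply: contraNneq d0 => x0; rewrite -xA x0 mul0mx.
have xi : qform A x x = x 0 i.
  by rewrite /qform xA -rowE !mxE.
have xi0 : 0 < x 0 i.
  rewrite lt_def -xi pA.2 andbT; apply: contra d0 => /eqP /(psd_ker pA).
  by rewrite xA => ->.
pose B := A - (x 0 i)^-1 *: (d^T *m d).
have pB : psd B.
  rewrite /B -xA; apply: psd_sub_rank1 => //; first by rewrite invr_ge0 ltW.
  by rewrite xi mulVf ?gt_eqF.
have dd p q : (d^T *m d) p q = ((p == i) && (q == i))%:R.
  by rewrite mxE big_ord1 !mxE -natrM mulnb.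
have Boff p q : (p == i) && (q == i) = false -> B p q = A p q.
  move=> pq; rewrite /B mxE [X in _ + X]mxE [X in - X]mxE dd pq.
  by rewrite mulr0 subr0.
have xB : x *m B = 0.
  rewrite mulmxBr xA -scalemxAr mulmxA.
  have -> : x *m d^T = (x 0 i)%:M.
    apply/rowP => z; rewrite ord1 !mxE (bigD1 i)//=.
    rewrite big1 ?addr0 ?mxE ?eqxx ?mulr1// => q qi.
    by rewrite !mxE (negPf qi) mulr0.
  by rewrite mul_scalar_mx scalerA mulVf ?gt_eqF// scale1r subrr.
have -> : A = B + (x 0 i)^-1 *: (d^T *m d) by rewrite subrK.
have neqs : [/\ j != i, k != i & l != i].
  move: ijkl; rewrite /= !inE !negb_or ![_ == i]eq_sym.
  by move=> /andP[/and3P[-> -> ->]].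
have [ji ki li] := neqs.
apply: cpmxD; last first.
  apply: cpmx_rank1; first by rewrite invr_ge0 ltW.
  by move=> p; rewrite mxE ler0n.
have off p q : q != i -> B p q = A p q.
  by move=> qi; rewrite Boff// (negPf qi) andbF.
by apply: (four_cycle_singular_cp ijkl pB _ _ _ _ _ _ x0 xB); rewrite off.
Qed.

Definition nonzero_entries n (A : 'M[R]_n) :=
  [set p : 'I_n * 'I_n | A p.1 p.2 != 0]%SET.

(** Let [b] be the row of index [i].  Its support is a clique, so a small multiple
    of [b^T b] can be subtracted without making any entry negative; the largest
    such multiple creates a new zero entry.  It is at most [(A i i)^-1], because
    of the entry [(i, i)], so that the difference stays positive semidefinite. *)
Lemma dnn_simplicial_sub n (A : 'M[R]_n) i : dnn A -> A i i != 0 ->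
  (forall j k, A i j != 0 -> A i k != 0 -> A j k != 0) ->
  exists a (b : 'rV[R]_n), [/\ 0 <= a, forall j, 0 <= b 0 j,
    dnn (A - a *: (b^T *m b)) &
    (#|nonzero_entries (A - a *: (b^T *m b))| < #|nonzero_entries A|)%N].
Proof.
move=> dA ii clique; have [pA A0] := dA; have [sA _] := pA.
pose b : 'rV[R]_n := (delta_mx 0 i : 'rV_n) *m A.
have bE j : b 0 j = A i j by rewrite /b -rowE mxE.
have b0 j : 0 <= b 0 j by rewrite bE.
pose P (p : 'I_n * 'I_n) := b 0 p.1 * b 0 p.2 != 0.
pose f (p : 'I_n * 'I_n) := A p.1 p.2 / (b 0 p.1 * b 0 p.2).
have Pii : P (i, i) by rewrite /P /= bE mulf_neq0.
case: (@arg_minP _ R _ (i, i) P f Pii) => -[j k] Pjk fmin.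
pose a := f (j, k).
have Ppos p : P p -> 0 < b 0 p.1 * b 0 p.2.
  by move=> Pp; rewrite lt_def mulr_ge0// andbT; exact: Pp.
have a0 : 0 <= a by rewrite /a /f /= divr_ge0// mulr_ge0.
have supp_b p q : b 0 p * b 0 q != 0 -> A p q != 0.
  by rewrite mulf_eq0 negb_or !bE => /andP[]; exact: clique.
have ab p q : a * (b 0 p * b 0 q) <= A p q.
  have [->|bpq] := eqVneq (b 0 p * b 0 q) 0; first by rewrite mulr0.
  by rewrite -ler_pdivlMr ?(Ppos (p, q))//; exact: (fmin (p, q)).
exists a, b; have BE p q :
    (A - a *: (b^T *m b)) p q = A p q - a * (b 0 p * b 0 q).
  by rewrite !mxE big_ord1 !mxE.
split=> //.
  apply: dnn_sub_rank1 => //; rewrite qform_delta -rowE mxE.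
  have := fmin (i, i) Pii; rewrite -/a /f /= bE => h.
  have Ai : 0 < A i i by rewrite lt_def ii A0.
  by rewrite -ler_pdivlMr// (le_trans h)// invfM mulrA mulfV// mul1r.
apply: proper_card; apply/properP; split.
  apply/fintype.subsetP => -[p q]; rewrite !inE /= BE; apply: contra => /eqP pq.
  rewrite pq sub0r; apply/eqP.
  have [->|/supp_b] := eqVneq (b 0 p * b 0 q) 0; first by rewrite mulr0 oppr0.
  by rewrite pq eqxx.
exists (j, k); rewrite !inE /=; first exact: supp_b.
by rewrite BE negbK /a /f /= divfK// subrr.
Qed.

(** Otherwise every vertex with nonzero diagonal entry has two nonadjacent
    neighbours.
    Let [j] and [k] be such neighbours of [i]: the nonadjacent neighbours of [j],
    as well as those of [k], can only be [i] and the fourth vertex. *)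
Lemma simplicial_or_four_cycle (A : 'M[R]_4) : dnn A -> A != 0 ->
  (exists2 i, A i i != 0 &
    forall j k, A i j != 0 -> A i k != 0 -> A j k != 0) \/
  exists i j k l, [/\ uniq [:: i; j; k; l], A i l = 0, A j k = 0 &
    [/\ A i j != 0, A i k != 0, A j l != 0 & A k l != 0]].
Proof.
move=> dA An0; have [[sA _] _] := dA.
have S p q : A p q = A q p by rewrite -{1}sA mxE.
have diag p q : A p q != 0 -> A p p != 0.
  by apply: contra => /eqP pp; rewrite (dnn_diag0 q dA pp).
have [|nsimp] := pselect (exists2 i, A i i != 0 &
  forall j k, A i j != 0 -> A i k != 0 -> A j k != 0); first by left.
right.
have nbrs p : A p p != 0 -> exists q r, [/\ A p q != 0, A p r != 0, A q r = 0,
    p != q & p != r /\ q != r].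
  move=> pp; apply: contrapT => H; apply: nsimp; exists p => // q r pq pr.
  apply/negP => /eqP qr; apply: H; exists q, r; split => //.
  - by apply: contraNneq pr => ->; rewrite qr.
  - split; first by apply: contraNneq pq => ->; rewrite S qr.
    apply: contraTneq pq => E; rewrite S negbK.
    by apply/eqP/(dnn_diag0 p dA); rewrite {2}E.
have [i ii] : exists i, A i i != 0.
  apply: contrapT => H; move/eqP: An0; apply; apply/matrixP => p q; rewrite mxE.
  by apply/eqP/negPn/negP => /diag pp; apply: H; exists p.
have [j [k [ij ik jk nij [nik njk]]]] := nbrs i ii.
have [l] : exists l, l \notin [:: i; j; k].
  apply: contrapT => H; have : (#|'I_4| <= size [:: i; j; k])%N.
    rewrite cardE; apply: uniq_leq_size (enum_uniq _) _ => y _.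
    by apply/negPn/negP => yn; apply: H; exists y.
  by rewrite card_ord.
rewrite !inE !negb_or => /and3P[li lj lk].
have u : uniq [:: i; j; k; l].
  by rewrite /= !inE !negb_or nij nik njk ![_ == l]eq_sym li lj lk.
have opposite p q : A p p != 0 -> A p q = 0 -> p != q ->
    (forall y, [\/ y = p, y = q, y = i | y = l]) -> A i l = 0 /\ A p l != 0.
  move=> pp pq npq cover; have [y [z [py pz yz npy [npz nyz]]]] := nbrs p pp.
  have il t : A p t != 0 -> p != t -> t = i \/ t = l.
    move=> pt npt; case: (cover t) => E; [| |by left|by right].
      by rewrite E eqxx in npt.
    by rewrite E pq eqxx in pt.
  case: (il y py npy) (il z pz npz) => yE [] zE; subst.
  - by rewrite eqxx in nyz.
  - by [].
  - by rewrite S.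
  - by rewrite eqxx in nyz.
have jj : A j j != 0 by apply: (diag j i); rewrite S.
have kk : A k k != 0 by apply: (diag k i); rewrite S.
have [il jl] : A i l = 0 /\ A j l != 0.
  apply: (opposite j k) => // y.
  by case: (ord4_cover u y);
    [constructor 3|constructor 1|constructor 2|constructor 4].
have [_ kl] : A i l = 0 /\ A k l != 0.
  apply: (opposite k j) => //; rewrite ?[A k j]S// 1?eq_sym// => y.
  by case: (ord4_cover u y);
    [constructor 3|constructor 2|constructor 1|constructor 4].
by exists i, j, k, l; split.
Qed.

(** Induction on the number of nonzero entries: as long as the pattern is not a
    four-cycle, subtracting a tensor square decreases this number. *)
Lemma dnn_cp (A : 'M[R]_4) : dnn A -> cpmx A.
Proof.
have [m] := ubnP #|nonzero_entries A|; elim: m A => // m IH A Am dA.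
have [->|A0] := eqVneq A 0; first exact: cpmx0.
have pos p q : A p q != 0 -> 0 < A p q by move=> h; rewrite lt_def h dA.2.
have [[i ii clique]|] := simplicial_or_four_cycle dA A0; last first.
  move=> [i [j [k [l [u il jk [/pos ij /pos ik /pos jl /pos kl]]]]]].
  exact: (four_cycle_cp u dA il jk ij ik jl kl).
have [a [b [a0 b0 dB lB]]] := dnn_simplicial_sub dA ii clique.
rewrite -(subrK (a *: (b^T *m b)) A); apply: cpmxD; last exact: cpmx_rank1.
by apply: IH => //; exact: leq_trans lB _.
Qed.

End MaxfieldMinc.

(** * Facial exposedness for the orthant *)


(** The row space of a symmetric matrix is the orthogonal complement of its
    kernel. *)
Lemma psd_submx_kermx (R : realType) n (A : 'M[R]_n) (b : 'rV[R]_n) :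
  A^T = A -> kermx A *m b^T = 0 -> exists x : 'rV[R]_n, b = x *m A.
Proof.
move=> sA Kb; apply/submxP; rewrite submxE -trmx_eq0 trmx_mul.
have : ((cokermx A)^T <= kermx A)%MS.
  by rewrite sub_kermx -[X in _ *m X]sA -trmx_mul mulmx_coker trmx0.
by case/submxP => X ->; rewrite -mulmxA Kb mulmx0.
Qed.

(** Membership of [b] in the row space keeps a small subtraction positive
    semidefinite, and the hypothesis on its support keeps it nonnegative. *)
Lemma dnn_sub_small (R : realType) n (A : 'M[R]_n) (b x : 'rV[R]_n) :
  dnn A -> b = x *m A -> (forall j, 0 <= b 0 j) ->
  (forall j k, A j k = 0 -> b 0 j * b 0 k = 0) ->
  exists2 e, 0 < e & dnn (A - e *: (b^T *m b)).
Proof.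
move=> dA bE b0 zb; have [pA A0] := dA.
pose s := \sum_j \sum_k b 0 j * b 0 k / A j k.
have t0 j k : 0 <= b 0 j * b 0 k / A j k by rewrite divr_ge0// mulr_ge0.
have q0 : 0 <= qform A x x by exact: pA.2.
have s0 : 0 <= s by apply: sumr_ge0 => j _; exact: sumr_ge0.
have d0 : 0 < 1 + qform A x x + s by lra.
exists (1 + qform A x x + s)^-1; first by rewrite invr_gt0.
rewrite bE; apply: dnn_sub_rank1 => //; first by rewrite invr_ge0 ltW.
  by rewrite mulrC ler_pdivrMr// mul1r; lra.
move=> j k; rewrite -bE; have [jk|jk] := eqVneq (A j k) 0.
  by rewrite zb// mulr0.
have Ajk : 0 < A j k by rewrite lt_def jk A0.
rewrite mulrC ler_pdivrMr// -ler_pdivrMl// mulrC.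
suff : b 0 j * b 0 k / A j k <= s by lra.
rewrite /s (bigD1 j)//= (bigD1 k)//= -addrA lerDl addr_ge0//;
  apply: sumr_ge0 => // p _.
exact: sumr_ge0.
Qed.

Section OrthogonalFrame.
Variables (R : realType) (E : euclidean_jordan_algebra R).
Variables (dot : inner_product E).
Hypothesis hdot : associative_form (jmul : E -> E -> E) dot.
Local Notation "x ** y" := (jmul x y) (at level 40, left associativity).
Variables (c : 'I_4 -> E).
Hypothesis cc : forall i, c i ** c i = c i.
Hypothesis c0 : forall i, c i <> 0.
Hypothesis corth : forall i j, i != j -> c i ** c j = 0.
Hypothesis cspan : forall x, exists a : 'I_4 -> R, x = \sum_i a i *: c i.
Implicit Types (T D : 'End(E)) (b : E).
Local Notation CP := (cp_cone dot (cone_of_squares E)).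

Let n i := dot (c i) (c i).
Let n0 i : 0 < n i. Proof. exact: dot_gt0. Qed.
Let dotcc i j : i != j -> dot (c i) (c j) = 0.
Proof. by move=> ij; rewrite -(cc i) hdot corth// dot0r. Qed.

Let dotc i (a : 'I_4 -> R) : dot (c i) (\sum_j a j *: c j) = a i * n i.
Proof.
rewrite dot_sumr (bigD1 i)//= big1 ?addr0 ?dotZr// => j ji.
by rewrite dotZr dotcc ?mulr0// eq_sym.
Qed.

Let expand x : x = \sum_i (dot (c i) x / n i) *: c i.
Proof.
have [a ->] := cspan x; apply: eq_bigr => i _; rewrite dotc mulfK//.
by rewrite gt_eqF.
Qed.

Let ext x y : (forall i, dot (c i) x = dot (c i) y) -> x = y.
Proof.
by move=> xy; rewrite (expand x) (expand y); under eq_bigr do rewrite xy.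
Qed.

Definition weights b : 'rV[R]_4 := \row_i dot (c i) b.

Lemma orthant_square b : cone_of_squares E b <-> forall i, 0 <= dot (c i) b.
Proof.
split=> [[w _ <-] i|b0]; first exact: (dot_idempotent_square_ge0 hdot).
exists (\sum_i Num.sqrt (dot (c i) b / n i) *: c i) => //; rewrite [RHS]expand.
rewrite jmul_suml; apply: eq_bigr => i _; rewrite linear_sumr (bigD1 i)//=.
rewrite big1 => [|j ji].
  rewrite addr0 jmulZl jmulZr cc scalerA -expr2 sqr_sqrtr//.
  by rewrite divr_ge0// ltW.
by rewrite jmulZl jmulZr corth ?scaler0// eq_sym.
Qed.

(** The matrix, in the frame [c], of the bilinear form defined by [T]. *)
Definition gram T : 'M[R]_4 := \matrix_(i, j) dot (c i) (T (c j)).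

Lemma gramD T D : gram (T + D) = gram T + gram D.
Proof. by apply/matrixP => i j; rewrite !mxE lfunE /= dotDr. Qed.

Lemma gramZ a T : gram (a *: T) = a *: gram T.
Proof. by apply/matrixP => i j; rewrite !mxE lfunE /= dotZr. Qed.

Lemma gramB T D : gram (T - D) = gram T - gram D.
Proof. by rewrite -scaleN1r gramD gramZ scaleN1r. Qed.

Lemma gram_inj : injective gram.
Proof.
move=> T D TD; apply/lfunP => x; have [a ->] := cspan x.
rewrite !linear_sum; apply: eq_bigr => j _ /=.
rewrite !linearZ /=; congr (_ *: _).
by apply: ext => i; have /matrixP/(_ i j) := TD; rewrite !mxE.
Qed.

Lemma gram_tensor b : gram (tensor_square dot b) = (weights b)^T *m weights b.
Proof.
apply/matrixP => i j; rewrite !mxE big_ord1 !mxE tensor_squareE dotZr.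
by rewrite (dotC dot b) mulrC.
Qed.

Lemma gram_sum (I : Type) (r : seq I) (f : I -> 'End(E)) :
  gram (\sum_(i <- r) f i) = \sum_(i <- r) gram (f i).
Proof.
apply: (big_morph gram) => [T D|]; first exact: gramD.
by rewrite -(scale0r (0 : 'End(E))) gramZ scale0r.
Qed.

(** In the frame the cone of squares is the orthant, so that the completely
    positive cone is that of the 4 x 4 matrices. *)
Lemma cp_cone_gram T : CP T <-> dnn (gram T).
Proof.
split=> [[k [a [_ Ka ->]]]|/dnn_cp[k [b [b0 TE]]]].
  rewrite gram_sum; split; last first.
    move=> i j; rewrite summxE; apply: sumr_ge0 => m _.
    by rewrite gram_tensor !mxE big_ord1 !mxE mulr_ge0//;
      exact: (orthant_square (a m)).1.
  split.
    rewrite linear_sum; apply: eq_bigr => m _.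
    by rewrite /= gram_tensor trmx_mul trmxK.
  move=> x; elim/big_ind: _ => [|M N M0 N0|m _].
  - by rewrite /qform mulmx0 mul0mx mxE.
  - by rewrite qformDm addr_ge0.
  - by rewrite gram_tensor qform_rank1 -expr2 sqr_ge0.
pose a (m : 'I_k) := \sum_i (b m 0 i / n i) *: c i.
have wa m : weights (a m) = b m.
  by apply/rowP => i; rewrite mxE dotc mulfVK// gt_eqF.
have Ka m : cone_of_squares E (a m).
  by apply/orthant_square => i; have /rowP/(_ i) := wa m; rewrite mxE => ->.
have -> : T = \sum_(m < k) tensor_square dot (a m).
  apply: gram_inj; rewrite TE gram_sum; apply: eq_bigr => m _.
  by rewrite gram_tensor wa.
have Ccone : is_cone CP by apply: cp_cone_cone; exact: cone_of_squares_cone.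
elim/big_ind: _ => [|? ?|m _]; [|exact: cp_cone_add|exact: cp_cone_tensor].
rewrite -(scale0r (tensor_square dot 0)); apply: Ccone => //.
apply: cp_cone_tensor.
by exists 0; rewrite ?jmul0l.
Qed.

Section ExposingFunctional.
Variable G : 'M[R]_4.
Local Notation K := (kermx G).

(** Detects, on doubly nonnegative matrices, those whose kernel contains the kernel
    of [G] and whose zero pattern contains that of [G]. *)
Definition exposing_value (M : 'M[R]_4) : R :=
  \sum_m qform M (row m K) (row m K) + \sum_i \sum_j (G i j == 0)%:R * M i j.

Let v m := \sum_i K m i *: c i.

(** The operator that represents [exposing_value] for the trace form; the matrix
    units come from tensor squares by polarization. *)
Definition exposing_operator : 'End(E) := \sum_m tensor_square dot (v m) +
  \sum_i \sum_j ((G i j == 0)%:R / 2) *: (tensor_square dot (c i + c j)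
    - tensor_square dot (c i) - tensor_square dot (c j)).

Lemma selfadjoint_tensor b x y :
  dot (tensor_square dot b x) y = dot x (tensor_square dot b y).
Proof. by rewrite !tensor_squareE dotZl dotZr (dotC dot x b) mulrC. Qed.

Lemma exposing_operator_selfadjoint : selfadjoint dot exposing_operator.
Proof.
move=> x y; rewrite /exposing_operator !add_lfunE !sum_lfunE dotDl dotDr.
congr (_ + _).
  rewrite dot_suml dot_sumr; apply: eq_bigr => m _.
  exact: selfadjoint_tensor.
rewrite dot_suml dot_sumr; apply: eq_bigr => i _.
rewrite !sum_lfunE dot_suml dot_sumr; apply: eq_bigr => j _.
rewrite !scale_lfunE !add_lfunE !opp_lfunE !dotE.
by rewrite !selfadjoint_tensor.
Qed.

Lemma exposing_operator_tensor b :
  trace_form (tensor_square dot b) exposing_operator =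
  exposing_value (gram (tensor_square dot b)).
Proof.
have wE i : dot b (c i) = weights b 0 i by rewrite mxE dotC.
have gE i j : ((weights b)^T *m weights b) i j = weights b 0 i * weights b 0 j.
  by rewrite !mxE big_ord1 !mxE.
rewrite trace_form_tensor /exposing_operator /exposing_value gram_tensor.
rewrite add_lfunE !sum_lfunE dotDr !dot_sumr; congr (_ + _).
  apply: eq_bigr => m _; rewrite tensor_squareE dotZr qform_rank1 mxE.
  rewrite (dotC dot (v m)) dot_sumr; congr (_ * _); apply: eq_bigr => i _;
    by rewrite dotZr wE !mxE mulrC.
apply: eq_bigr => i _; rewrite sum_lfunE dot_sumr; apply: eq_bigr => j _.
rewrite scale_lfunE !add_lfunE !opp_lfunE !tensor_squareE !dotE !wE.
rewrite !(dotC dot (c _)) !wE gE; lra.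
Qed.

Lemma exposing_operatorE T : CP T ->
  trace_form T exposing_operator = exposing_value (gram T).
Proof.
case=> k [a [_ _ ->]]; rewrite trace_form_suml gram_sum.
rewrite /exposing_value; under eq_bigr do rewrite exposing_operator_tensor.
rewrite /exposing_value big_split /=; congr (_ + _).
  rewrite exchange_big; apply: eq_bigr => m _ /=.
  apply: esym; apply: (big_morph (fun M => qform M (row m K) (row m K))).
    by move=> M N; exact: qformDm.
  by rewrite /qform mulmx0 mul0mx mxE.
rewrite exchange_big; apply: eq_bigr => i _ /=.
rewrite exchange_big; apply: eq_bigr => j _ /=.
by rewrite summxE mulr_sumr.
Qed.

Lemma exposing_value_ge0 M : dnn M -> 0 <= exposing_value M.
Proof.
move=> [[_ M0] Mp]; rewrite addr_ge0//; apply: sumr_ge0 => // i _.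
by apply: sumr_ge0 => j _; rewrite mulr_ge0.
Qed.

Lemma exposing_value_eq0 M : dnn M -> exposing_value M = 0 <->
  (forall m, qform M (row m K) (row m K) = 0) /\
  (forall i j, G i j = 0 -> M i j = 0).
Proof.
move=> [[_ M0] Mp]; have Z0 i j : 0 <= (G i j == 0)%:R * M i j.
  by rewrite mulr_ge0.
have A0 : 0 <= \sum_m qform M (row m K) (row m K) by exact: sumr_ge0.
have B0 : 0 <= \sum_i \sum_j (G i j == 0)%:R * M i j.
  by apply: sumr_ge0 => i _; exact: sumr_ge0.
split=> [/eqP|[q0 z0]].
  rewrite paddr_eq0// => /andP[/eqP qs /eqP zs]; split.
    by move=> m; apply: (psumr_eq0P _ qs).
  move=> i j Gij.
  have zi : \sum_j (G i j == 0)%:R * M i j = 0.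
    by apply: (psumr_eq0P _ zs) => // p _; exact: sumr_ge0.
  have : (G i j == 0)%:R * M i j = 0 by apply: (psumr_eq0P _ zi).
  by rewrite Gij eqxx mul1r.
rewrite /exposing_value big1 ?add0r// big1// => i _; rewrite big1// => j _.
by have [Gij|] := eqVneq (G i j) 0; rewrite ?mul0r// z0// mulr0.
Qed.

End ExposingFunctional.

(** Let [T] in [F] have maximal rank plus number of nonzero entries, and let [G] be
    its matrix.  Adding an element of [F] to [T] can neither shrink the kernel of
    [G] nor its zero pattern, so the functional vanishes on [F].  Conversely, when
    it vanishes at a sum of tensor squares, each of them can be subtracted from
    [T], with a small coefficient, inside the completely positive cone, and
    therefore belongs to [F]. *)
Lemma hadamard_facially_exposed :
  facially_exposed (selfadjoint dot) (@trace_form R E) CP.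
Proof.
move=> F [[T0 FT0] FCP Fconv Fcone Fface].
have Fadd := convex_cone_add Fconv Fcone.
pose mu T := (\rank (gram T) + #|nonzero_entries (gram T)|)%N.
pose P m := `[< exists2 T, F T & mu T = m >].
have exP : exists m, P m by exists (mu T0); apply/asboolP; exists T0.
have ubP m : P m -> (m <= 4 + 16)%N.
  move=> /asboolP[T _ <-]; rewrite leq_add ?rank_leq_row//.
  by rewrite (leq_trans (max_card _))// card_prod card_ord.
case: (ex_maxnP exP ubP) => m /asboolP[T FT muT] maxm.
have dT : dnn (gram T) by apply/cp_cone_gram; exact: FCP.
set G := gram T in dT; have [[sG psdG] G0] := dT.
exists (exposing_operator G).
  split; first exact: exposing_operator_selfadjoint.
  move=> S CPS; rewrite exposing_operatorE//; apply: exposing_value_ge0.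
  exact/cp_cone_gram.
apply/seteqP; split=> S /=.
  move=> FS; split; first exact: FCP.
  rewrite exposing_operatorE; last exact: FCP.
  have dS : dnn (gram S) by apply/cp_cone_gram; exact: FCP.
  have FTS : F (T + S) by exact: Fadd.
  have dTS : dnn (gram (T + S)) by apply/cp_cone_gram; exact: FCP.
  have PTS : P (mu (T + S)) by apply/asboolP; exists (T + S).
  have := maxm _ PTS; rewrite -muT /mu gramD -/G => mule.
  rewrite gramD in dTS.
  have kle : (kermx (G + gram S) <= kermx G)%MS.
    apply/rV_subP => x /sub_kermxP xS; apply/sub_kermxP; apply: psd_ker dT.1 _.
    have : qform (G + gram S) x x = 0 by rewrite /qform xS mul0mx mxE.
    have := psdG x; have := dS.1.2 x; rewrite qformDm; lra.
  have addE p q : (G + gram S) p q = G p q + gram S p q by rewrite [LHS]mxE.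
  have sle : nonzero_entries G \subset nonzero_entries (G + gram S).
    apply/fintype.subsetP => -[p q]; rewrite !inE /= addE => pq.
    rewrite gt_eqF//.
    by rewrite ltr_wpDr ?dS.2// lt_def pq G0.
  have rle : (\rank G <= \rank (G + gram S)%R)%N.
    have aux p q : (p <= 4 -> 4 - q <= 4 - p -> p <= q)%N by clear; lia.
    apply: aux (rank_leq_row G) _; rewrite -!mxrank_ker; exact: mxrankS kle.
  have cle := subset_leq_card sle.
  have [eqr eqc] : \rank G = \rank (G + gram S)%R /\
      #|nonzero_entries G| = #|nonzero_entries (G + gram S)|.
    have aux p q p' q' : (p <= p' -> q <= q' -> p' + q' <= p + q ->
      p = p' /\ q = q')%N by clear; lia.
    exact: aux rle cle mule.
  apply/(exposing_value_eq0 _ dS); split=> [k|p q pq].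
    have kge : (kermx G <= kermx (G + gram S))%MS.
      by rewrite -(mxrank_leqif_sup kle) !mxrank_ker eqr.
    have /sub_kermxP kS : (row k (kermx G) <= kermx (G + gram S))%MS.
      by rewrite (submx_trans _ kge)// row_sub.
    set x := row k _ in kS *.
    have : qform (G + gram S) x x = 0 by rewrite /qform kS mul0mx mxE.
    have := psdG x; have := dS.1.2 x; rewrite qformDm; lra.
  have eqs : nonzero_entries G = nonzero_entries (G + gram S).
    by apply/eqP; rewrite finset.eqEcard sle eqc leqnn.
  have : (p, q) \notin nonzero_entries G by rewrite inE /= pq eqxx.
  by rewrite eqs inE /= addE pq add0r negbK => /eqP.
move=> [CPS]; have [k [a [_ Ka SE]]] := CPS.
have CPa m' : CP (tensor_square dot (a m')) by exact: cp_cone_tensor.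
have da m' : dnn (gram (tensor_square dot (a m'))) by apply/cp_cone_gram.
rewrite SE trace_form_suml => D0.
have val0 m' : exposing_value G (gram (tensor_square dot (a m'))) = 0.
  rewrite -exposing_operatorE//; apply: (psumr_eq0P _ D0) => // p _.
  by rewrite exposing_operatorE//; exact: exposing_value_ge0.
have Fa m' : F (tensor_square dot (a m')).
  have [] := (exposing_value_eq0 G (da m')).1 (val0 m').
  rewrite gram_tensor; set b := weights (a m') => q0 z0.
  have [x bx] : exists x : 'rV[R]_4, b = x *m G.
    apply: psd_submx_kermx => //; apply/row_matrixP => p.
    apply/rowP => z; rewrite ord1 row_mul row0 [RHS]mxE.
    have := q0 p; rewrite qform_rank1 => /eqP; rewrite mulf_eq0 orbb => /eqP h.
    transitivity ((row p (kermx G) *m b^T)^T 0 0); first by rewrite [RHS]mxE.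
    by rewrite trmx_mul trmxK.
  have b0 j : 0 <= b 0 j by rewrite mxE; exact: (orthant_square (a m')).1.
  have zb j l : G j l = 0 -> b 0 j * b 0 l = 0.
    by move/z0; rewrite mxE big_ord1 mxE.
  have [e e0 de] := dnn_sub_small dT bx b0 zb.
  have CPe : CP (T - e *: tensor_square dot (a m')).
    by apply/cp_cone_gram; rewrite gramB gramZ gram_tensor.
  have Ccone : is_cone CP by apply: cp_cone_cone; exact: cone_of_squares_cone.
  have [_ Fe] : F (T - e *: tensor_square dot (a m')) /\
      F (e *: tensor_square dot (a m')).
    by apply: Fface => //; [exact: Ccone (ltW e0) _|rewrite subrK].
  rewrite -[tensor_square _ _](scalerK (negbT (gt_eqF e0))).
  by apply: Fcone => //; rewrite invr_ge0 ltW.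
elim/big_ind: _ => [|? ?|m' _]; [|exact: Fadd|exact: Fa].
by rewrite -(scale0r T); exact: Fcone.
Qed.

End OrthogonalFrame.

(** * The theorem *)


Lemma isomorphic_frame (R : realType) (E : euclidean_jordan_algebra R) r :
  jordan_isomorphic E (hadamard_eja R r) -> exists c : 'I_r -> E,
  [/\ forall i, jmul (c i) (c i) = c i, forall i, c i <> 0,
      forall i j, i != j -> jmul (c i) (c j) = 0 &
      forall x, exists a : 'I_r -> R, x = \sum_i a i *: c i].
Proof.
case=> f [[g gf fg] fM]; pose e i : 'rV[R]_r := delta_mx 0 i.
have fc i : f (g (e i)) = e i by exact: fg.
have inj := can_inj gf.
exists (fun i => g (e i)); split.
- move=> i; apply: inj; rewrite fM fc; apply/rowP => j; rewrite !mxE eqxx /=.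
  by rewrite -natrM mulnb andbb.
- move=> i /(congr1 f); rewrite fc linear0 => /rowP/(_ i); rewrite !mxE !eqxx.
  by move/eqP; rewrite oner_eq0.
- move=> i j ij; apply: inj; rewrite fM !fc linear0; apply/rowP => k.
  rewrite !mxE eqxx /= -natrM mulnb; have [->|//] := eqVneq k i.
  by rewrite (negPf ij).
- move=> x; exists (fun i => (f x : 'rV[R]_r) 0 i); apply: inj.
  rewrite linear_sum [LHS](row_sum_delta (f x)); apply: eq_bigr => i _.
  by rewrite linearZ /= fc.
Qed.

Theorem theorem5p4 (R : realType) (E : euclidean_jordan_algebra R)
    (dot : inner_product E) (hdot : associative_form (jmul : E -> E -> E) dot)
    (hrank : has_rank E 4) :
  facially_exposed (selfadjoint dot) (@trace_form R E)
    (cp_cone dot (cone_of_squares E)) <->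
  jordan_isomorphic E (hadamard_eja R 4).
Proof.
split=> [exposed|/isomorphic_frame[c [cc c0 corth cspan]]].
  have [c frame] := hrank.
  have [diag|[i [j [u [ij u0 hu]]]]] := frame_diagonal_or_half frame.
    exact: (diagonal_hadamard hdot frame diag).
  by case: (frame_half_not_facially_exposed hdot frame ij u0 hu).
exact: (hadamard_facially_exposed hdot cc c0 corth cspan).
Qed.
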